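(* Let $1\to F\xrightarrow{i} G\xrightarrow{\rho} H\to 1$ be an extension (short exact sequence) of countable discrete groups in which $F$ is locally finite and $H$ is virtually $\mathbb{Z}$. Let $\alpha: G\curvearrowright X$ be a minimal action on the Cantor set $X$ such that the orbit space $X/F$ is Hausdorff. Then $\alpha$ is almost finite in measure if and only if $\alpha$ is essentially free.
   Context: All actions are by homeomorphisms. A group is locally finite if each of its finitely generated subgroups is finite; it is virtually $\mathbb{Z}$ if it has a finite-index subgroup isomorphic to $\mathbb{Z}$. (The group $G$ above is then amenable.) $X/F$ is the space of orbits of $F$ (identified with $i(F)\le G$) with the quotient topology. An action is minimal if all orbits are dense. $M_G(X)$ is the set of $G$-invariant Borel probability measures on $X$. The action is essentially free if for every $s\in G\setminus\{e\}$ the fixed point set $F_s=\{x\in X: sx=x\}$ satisfies $\sup_{\mu\in M_G(X)}\mu(F_s)=0$. Fix a compatible metric on $X$. For finite $K\subset G$ and $\epsilon>0$, a finite set $S\subset G$ is $(K,\epsilon)$-F{\o}lner if $|KS\setminus S|<\epsilon|S|$. A tower is a pair $(S,B)$ with $S\subset G$ finite and $B\subset X$ such that the sets $sB$, $s\in S$, are pairwise disjoint; $S$ is its shape and $B$ its base. A castle is a finite family of towers $\{(S_i,B_i): i\in I\}$ such that $sB_i\cap tB_j=\emptyset$ for all $s\in S_i$, $t\in S_j$, $i\neq j$; it is open if all $B_i$ are open. An action of a countable amenable group $G$ on a compact metrizable space $X$ is almost finite in measure if for every finite $K\subset G$ and $\epsilon>0$ there is an open castle $\{(S_i,B_i): i\in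 I\}$ such that (i) each $S_i$ is $(K,\epsilon)$-F{\o}lner; (ii) $\operatorname{diam}(sB_i)<\epsilon$ for all $s\in S_i$, $i\in I$; (iii) $\sup_{\mu\in M_G(X)}\mu\big(X\setminus\bigsqcup_{i\in I}S_iB_i\big)<\epsilon$. *)

(* Defs.v *)
From HB Require Import structures.
From mathcomp Require Import all_boot all_order all_algebra finmap.
From mathcomp Require Import generic_quotient.
From mathcomp Require Import all_classical all_reals all_analysis.
Set Implicit Arguments.
Unset Strict Implicit.
Unset Printing Implicit Defensive.
Import Order.TTheory GRing.Theory Num.Theory.
Local Open Scope classical_set_scope.
Local Open Scope ring_scope.

(* Measurable types are pointed in MathComp-Analysis, so a metric space must
   come with an (arbitrary) point in order to carry Borel measures. *)
#[short(type="pmetricType")]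
HB.structure Definition PointedMetric (K : numDomainType) :=
  {M of Pointed M & Metric K M}.

Section groups.
Variable G : groupType.

Definition subgroup (L : set G) : Prop := group_closed (mem L).

Definition generated (K : set G) : set G := smallest subgroup K.

Definition locally_finite : Prop :=
  forall K : set G, finite_set K -> finite_set (generated K).

Definition finite_index (L : set G) : Prop :=
  finite_set (range (fun x : G => [set (x * y)%g | y in L])).

(* [to_multiplicative int] is the additive group of the integers. *)
Definition isomorphic_to_Z (L : set G) : Prop :=
  exists f : {multiplicative (Algebra.to_multiplicative int) -> G},
    injective f /\ range f = L.

Definition virtually_Z : Prop :=
  exists L : set G, [/\ subgroup L, finite_index L & isomorphic_to_Z L].

End groups.

Definition short_exact (F G H : groupType)
    (i : {multiplicative F -> G}) (rho : {multiplicative G -> H}) : Prop :=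
  [/\ injective i,
      range i = [set g | rho g = 1%g] &
      range rho = [set: H] ].

Definition homeomorphism (X Y : topologicalType) (f : X -> Y) : Prop :=
  continuous f /\
  exists g : Y -> X, [/\ cancel f g, cancel g f & continuous g].

Definition is_cantor_set (X : topologicalType) : Prop :=
  exists f : cantor_space -> X, homeomorphism f.

Record action (G : groupType) (X : topologicalType) := Action {
  act :> G -> X -> X;
  act1 : forall x, act 1%g x = x;
  actM : forall s t x, act (s * t)%g x = act s (act t x);
  act_homeo : forall s, homeomorphism (act s) }.

Section restriction.
Variables (F G : groupType) (X : topologicalType).
Variables (i : {multiplicative F -> G}) (a : action G X).

Fact res_act1 x : a (i 1%g) x = x.
Proof.
have i1 : i 1%g = 1%g by apply: (mulgI (i 1%g)); rewrite -gmulfM !mulg1.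
by rewrite i1 act1.
Qed.

Fact res_actM s t x : a (i (s * t)%g) x = a (i s) (a (i t) x).
Proof. by rewrite gmulfM actM. Qed.

Definition restrict_action : action F X :=
  Action res_act1 res_actM (fun s => act_homeo a (i s)).

End restriction.

Section dynamics.
Variables (G : groupType) (X : topologicalType) (a : action G X).

Definition orbit_of (x : X) : set X := range (a ^~ x).

Definition minimal_action : Prop := forall x, dense (orbit_of x).

Definition same_orbit (x y : X) : bool := `[< orbit_of x y >].

Fact same_orbit_refl : reflexive same_orbit.
Proof. by move=> x; apply/asboolP; exists 1%g => //; rewrite act1. Qed.

Fact same_orbit_sym : symmetric same_orbit.
Proof.
suff H x y : same_orbit x y -> same_orbit y x.
  by move=> x y; apply/idP/idP; exact: H.
move=> /asboolP[s _ /= <-]; apply/asboolP; exists s^-1%g => //=.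
by rewrite -actM mulVg act1.
Qed.

Fact same_orbit_trans : transitive same_orbit.
Proof.
move=> y x z /asboolP[s _ /= <-] /asboolP[t _ /= <-]; apply/asboolP.
by exists (t * s)%g => //=; rewrite actM.
Qed.

Canonical same_orbit_equiv :=
  EquivRel same_orbit same_orbit_refl same_orbit_sym same_orbit_trans.

Definition orbit_space : topologicalType :=
  quotient_topology {eq_quot same_orbit}%qT.

Definition fixed_points (s : G) : set X := [set x | a s x = x].

End dynamics.

Definition borel (X : ptopologicalType) := g_sigma_algebraType (@open X).

(* The extra 0 only serves to give the empty set diameter 0. *)
Definition diam (R : realType) (X : metricType R) (A : set X) : \bar R :=
  ereal_sup (0%E |` [set (mdist x y)%:E | x in A & y in A]).

Section folner_and_castles.
Variables (R : realType) (G : groupType).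

Definition folner (K : {fset G}) (eps : R) (S : {fset G}) : Prop :=
  (#|` ([fset (k * s)%g | k in K, s in S] `\` S)%fset|)%:R < eps * (#|` S|)%:R.

Variables (X : topologicalType) (a : action G X).

Definition tower (S : {fset G}) (B : set X) : Prop :=
  trivIset [set` S] (fun s => a s @` B).

Definition castle (I : finType) (S : I -> {fset G}) (B : I -> set X) : Prop :=
  (forall i, tower (S i) (B i)) /\
  (forall i j s t, s \in S i -> t \in S j -> i != j ->
     (a s @` B i) `&` (a t @` B j) = set0).

Definition footprint (I : finType) (S : I -> {fset G}) (B : I -> set X)
    : set X :=
  \bigcup_(i in [set: I]) \bigcup_(s in [set` S i]) (a s @` B i).

End folner_and_castles.

Section measures.
Variables (R : realType) (G : groupType) (X : pmetricType R).
Variable a : action G X.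

(* Since s ranges over a group, this is the same as mu (sA) = mu A. *)
Definition invariant_measures : set (probability (borel X) R) :=
  [set mu | forall s (A : set (borel X)), measurable A ->
              mu (a s @^-1` A) = mu A].

(* The supremum of the empty set is -oo, but for an amenable group acting on a
   nonempty compact metric space [invariant_measures] is nonempty. *)
Definition sup_measure (A : set X) : \bar R :=
  ereal_sup [set mu A | mu in invariant_measures].

Definition essentially_free : Prop :=
  forall s : G, s != 1%g -> sup_measure (fixed_points a s) = 0%E.

Definition almost_finite_in_measure : Prop :=
  forall (K : {fset G}) (eps : R), 0 < eps ->
  exists (I : finType) (S : I -> {fset G}) (B : I -> set X),
    [/\ castle a S B /\ (forall i, open (B i)),
        forall i, folner K eps (S i),
        forall i s, s \in S i -> (diam (a s @` B i) < eps%:E)%E &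
        (sup_measure (~` footprint a S B) < eps%:E)%E].

End measures.

(* Main.v *)
From HB Require Import structures.
From mathcomp Require Import all_boot all_order all_algebra finmap.
From mathcomp Require Import generic_quotient.
From mathcomp Require Import all_classical all_reals all_analysis.
From mathcomp Require Import zify lra.
Require Import Defs.

(** In a castle whose shapes are (K, delta)-Folner, the sets r B_i with
    r in K S_i \ S_i have total measure at most delta for every invariant
    probability measure mu, because the numbers |S_i| mu(B_i) add up to at
    most 1 (boundary_measure_le). Both implications are applications of this
    estimate.

    Suppose that the action is almost finite in measure. If s <> 1 fixes a
    point r b of a level r B_i, then r b = (s r) b, so s r is not in S_i and the
    point lies in the boundary for K = {s}. Hence mu(F_s) is at most the measure
    missed by the castle plus delta, both arbitrarily small. The supremum over
    the invariant measures is 0 and not -oo because an invariant measure exists.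
    Indeed, let t in G lift a generator of a copy of Z of finite index in H; then
    G = T t^Z i(F) for a finite set T, and the boxes T t^[-L, L] i(P), with P a
    finite subgroup of F that depends on L, are Folner (locally_finite_folner).
    Averages of a point mass along them have an ultralimit on the clopen sets,
    which extends to an invariant Borel probability measure by compactness and
    the theorem of Caratheodory (limit_measure, folner_invariant_measure).

    Suppose now that the action is essentially free. The F-orbits are closed
    since X/F is Hausdorff. A compact, countable, homogeneous orbit has an
    isolated point, by the argument of Baire, hence is finite. If F were
    infinite, every point would be fixed by some element of F other than 1, and
    X would be a countable union of null sets; so F is finite (kernel_finite).
    Therefore G has linear growth, and the boxes S = T t^[-L, L] i(F) satisfy
    |S^-1 S| <= C |S| with C independent of L (folner_doubling).

    This doubling property yields the castle, in rounds that each cover a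
    proportion 1/C of what is left (castle_exhaustion). Given the part P already
    covered and a new shape S such that the shapes used for P are Folner
    relatively to S^-1, let A be the set of the points whose S-translates all
    avoid P. Choose greedily M inside A, maximal with the sets s M, s in S,
    disjoint: by maximality A is covered by the translates of M by S^-1 S, so
    mu(A) <= C |S| mu(M) = C mu(S M), while the complement of P differs from A by
    a boundary of small measure. The choice is possible in a clopen way off a
    neighbourhood of the fixed points of the elements of S^-1 S other than 1.
    These points form a closed set that every invariant measure neglects, so by
    compactness of the space of measures some clopen neighbourhood of it has
    small measure uniformly in mu (small_clopen_nbhd). *)

Set Implicit Arguments.
Unset Strict Implicit.
Unset Printing Implicit Defensive.
Import Order.TTheory GRing.Theory Num.Theory.
Import numFieldNormedType.Exports.
Local Open Scope classical_set_scope.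
Local Open Scope ring_scope.

(** * Folner sets and averages *)

Section folner_sets.
Variables (R : realType) (G : groupType).

Lemma folnerS (K K' : {fset G}) (e e' : R) (S : {fset G}) :
  (K `<=` K')%fset -> e' <= e -> folner K' e' S -> folner K e S.
Proof.
move=> KK' ee'; rewrite /folner => fS.
apply: (@le_lt_trans _ _ (#|` ([fset (k * s)%g | k in K', s in S] `\` S)%fset|%:R)).
  rewrite ler_nat; apply/fsubset_leq_card/fsetSD/fsubsetP => _ /imfset2P[k /= kK [s /= sS ->]].
  by apply: in_imfset2 => //=; exact: (fsubsetP KK').
by apply: (lt_le_trans fS); rewrite ler_wpM2r.
Qed.

Lemma folner_neq0 (K : {fset G}) (e : R) (S : {fset G}) :
  folner K e S -> exists s, s \in S.
Proof.
move=> fS; apply/fset0Pn/negP => /eqP S0; move: fS.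
by rewrite /folner S0 cardfs0 mulr0 ltNge ler0n.
Qed.

Lemma ler_sum_fset (K : choiceType) (A B : {fset K}) (f : K -> R) :
  (forall x, 0 <= f x) -> (A `<=` B)%fset ->
  \sum_(x <- A) f x <= \sum_(x <- B) f x.
Proof.
move=> f0 AB; rewrite [leRHS](big_fsetID _ (mem A))/=.
have -> : [fset x in B | x \in A]%fset = A.
  by apply/fsetP => x; rewrite !inE/= andb_idl//; exact: fsubsetP.
by rewrite lerDl sumr_ge0.
Qed.

Lemma sum1_fset (K : choiceType) (A : {fset K}) :
  \sum_(x <- A) 1 = (#|` A|)%:R :> R.
Proof. by rewrite big_const_seq count_predT iter_addr_0. Qed.

(** Translating by g moves S only into itself or into K S \ S, so an average over
    a Folner set is almost invariant. *)
Lemma ler_sum_translate (S K : {fset G}) (g : G) (f : G -> R) :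
  g \in K -> (forall x, 0 <= f x <= 1) ->
  \sum_(s <- S) f (g * s)%g <= \sum_(s <- S) f s +
    (#|` ([fset (k * s)%g | k in K, s in S] `\` S)%fset|)%:R.
Proof.
move=> gK f01.
have -> : \sum_(s <- S) f (g * s)%g = \sum_(r <- [fset (g * s)%g | s in S]%fset) f r.
  by rewrite big_imfset//= => x y _ _ /mulgI.
rewrite (big_fsetID _ (mem S))/= lerD//.
  apply: ler_sum_fset => [x|]; first by case/andP: (f01 x).
  by apply/fsubsetP => x; rewrite !inE => /andP[].
set D := (X in \sum_(i <- X) _).
apply: (@le_trans _ _ (\sum_(i <- D) 1)).
  by apply: ler_sum => x _; case/andP: (f01 x).
rewrite sum1_fset ler_nat; apply/fsubset_leq_card/fsubsetP => x.
rewrite in_fsetD !inE => /andP[/imfsetP[s /= sS ->] ->] /=.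
exact: in_imfset2.
Qed.

End folner_sets.

(** * Extensions of a locally finite group by a virtually cyclic group *)

Section integer_powers.
Variables (G : groupType) (t : G).
Local Open Scope group_scope.

Definition expgz (n : int) : G :=
  match n with Posz m => t ^+ m | Negz m => t ^- m.+1 end.

Lemma expgzS n : expgz (n + 1)%R = expgz n * t.
Proof.
case: n => [m|m]; first by rewrite -PoszD addn1 /= expgSr.
have -> : (Negz m + 1 = - m%:Z)%R by rewrite NegzE -addn1 PoszD opprD subrK.
by case: m => [|m]; rewrite /= ?expg1 ?mulVg// [in RHS]expgS invgM mulgVK.
Qed.

Lemma expgzD m n : expgz (m + n)%R = expgz m * expgz n.
Proof.
elim: n => [|n IH|n IH]; first by rewrite addr0 mulg1.
  by rewrite -addn1 PoszD addrA !expgzS IH mulgA.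
apply: (mulIg t); rewrite -mulgA -!expgzS -addn1 PoszD opprD addrA.
by rewrite !subrK.
Qed.

Lemma expgzN n : expgz (- n)%R = (expgz n)^-1.
Proof. by apply: (mulgI (expgz n)); rewrite mulgV -expgzD subrr. Qed.

End integer_powers.

Lemma group_morph1 (A B : groupType) (f : {multiplicative A -> B}) : f 1%g = 1%g.
Proof. by apply: (mulgI (f 1%g)); rewrite -gmulfM !mulg1. Qed.

Lemma group_morphV (A B : groupType) (f : {multiplicative A -> B}) x :
  f x^-1%g = (f x)^-1%g.
Proof. by apply: (mulgI (f x)); rewrite -gmulfM !mulgV group_morph1. Qed.

(** The index is stated as the finiteness of the set of cosets; choosing a point
    in each of them gives a finite set of representatives. *)
Lemma finite_cosets (H : groupType) (L : set H) : subgroup L -> finite_index L ->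
  exists D : {fset H}, forall x, exists2 d, d \in D & L (d^-1 * x)%g.
Proof.
move=> [/set_mem L1 _] /finite_fsetP[E rE].
pose rep (c : set H) := xget 1%g [set d : H | [set (d * y)%g | y in L] = c].
exists (rep @` E)%fset => x.
pose c := [set (x * y)%g | y in L].
have cE : c \in E.
  by have : range (fun x : H => [set (x * y)%g | y in L]) c by [exists x]; rewrite rE.
exists (rep c); first by apply/imfsetP; exists c.
have repE : [set (rep c * y)%g | y in L] = c.
  by rewrite /rep; case: xgetP => [d _ //|/(_ x) []].
have : [set (rep c * y)%g | y in L] x by rewrite repE; exists 1%g; rewrite ?mulg1.
by case=> l Ll lx; rewrite -lx mulKg.
Qed.

Section extension_decomposition.
Variables (F G H : groupType).
Variables (i : {multiplicative F -> G}) (rho : {multiplicative G -> H}).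
Hypothesis exact_i_rho : short_exact i rho.

(** The element t lifts a generator of a copy of Z of finite index in H, and T
    lifts representatives of its cosets; the remaining factor is in the kernel
    of rho, which is the image of i. *)
Lemma extension_decomposition : virtually_Z H ->
  exists (T : {fset G}) (t : G),
    (forall n, rho (expgz t n) = 1%g -> n = 0) /\
    forall g, exists tau n f, tau \in T /\ g = (tau * expgz t n * i f)%g.
Proof.
have [_ ker_rho im_rho] := exact_i_rho.
case=> L [sL fiL [f [f_inj fL]]].
have [D DL] := finite_cosets sL fiL.
have lift h : exists g, rho g = h.
  by have : range rho h by [rewrite im_rho]; case=> g _ <-; exists g.
have [s sK] := choice lift.
(* Reading f on int turns its multiplicativity into fz (m + n) = fz m * fz n. *)
pose fz (n : int) : H := f n.
have fzD m n : fz (m + n) = (fz m * fz n)%g by exact: (gmulfM (s := f) m n).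
have fz0 : fz 0 = 1%g by exact: (group_morph1 f).
pose t := s (fz 1).
have rhoE n : rho (expgz t n) = fz n.
  elim: n => [|n IH|n IH]; first by rewrite group_morph1 fz0.
    by rewrite -addn1 PoszD expgzS gmulfM IH fzD sK.
  apply: (mulIg (fz 1)); rewrite -{1}(sK (fz 1)) -gmulfM -expgzS -fzD.
  by rewrite -addn1 PoszD opprD subrK.
exists (s @` D)%fset, t; split=> [n|g].
  by rewrite rhoE -fz0; exact: f_inj.
have [d dD] := DL (rho g); rewrite -fL => -[n _ fn].
have : [set g | rho g = 1%g] ((s d * expgz t n)^-1 * g)%g.
  by rewrite /= gmulfM group_morphV gmulfM sK rhoE /fz fn mulVKg mulVg.
rewrite -ker_rho => -[x _ ix]; exists (s d), n, x; split.
  by apply/imfsetP; exists d.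
by rewrite ix mulVKg.
Qed.

End extension_decomposition.

Definition zint (a : int) (n : nat) : seq int := [seq a + k%:Z | k <- iota 0 n].

Lemma mem_zint a n x : (x \in zint a n) = (a <= x < a + n%:Z).
Proof.
apply/mapP/idP => [[k]|/andP[ax xan]].
  by rewrite mem_iota => /andP[_ kn] ->; lia.
by exists `|x - a|%N; [rewrite mem_iota|]; lia.
Qed.

Lemma size_zint a n : size (zint a n) = n.
Proof. by rewrite size_map size_iota. Qed.

Lemma uniq_zint a n : uniq (zint a n).
Proof. by rewrite map_inj_uniq ?iota_uniq// => x y; lia. Qed.

Local Notation segment L := (zint (- L%:Z) (2 * L).+1).

Section boxes.
Variables (F G H : groupType).
Variables (i : {multiplicative F -> G}) (rho : {multiplicative G -> H}).
Hypothesis exact_i_rho : short_exact i rho.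
Variables (T : {fset G}) (t : G).
Hypothesis t_inf : forall n, rho (expgz t n) = 1%g -> n = 0.
Hypothesis T_cover : forall g, exists tau n f,
  tau \in T /\ g = (tau * expgz t n * i f)%g.
Local Notation phi := (expgz t).

Lemma rho_kernel x : rho (i x) = 1%g.
Proof. by have [_ + _] := exact_i_rho => /seteqP[+ _]; apply; exists x. Qed.

Lemma kernel_conj (g : G) x : exists y, (i x * g = g * i y)%g.
Proof.
have [_ ker_rho _] := exact_i_rho.
have : [set g | rho g = 1%g] (g^-1 * i x * g)%g.
  by rewrite /= !gmulfM rho_kernel mulg1 -gmulfM mulVg group_morph1.
by rewrite -ker_rho => -[y _ iy]; exists y; rewrite iy -mulgA mulVKg.
Qed.

Definition box (J : seq int) (P : {fset F}) : {fset G} :=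
  [fset x in [seq (x * i f)%g |
    x <- [seq (tau * phi j)%g | tau <- T, j <- J], f <- P]]%fset.

Lemma boxP J (P : {fset F}) x : reflect (exists tau j f,
  [/\ tau \in T, j \in J, f \in P & x = (tau * phi j * i f)%g]) (x \in box J P).
Proof.
rewrite inE; apply: (iffP allpairsP).
  move=> [[_ f] [/= /allpairsP[[tau j] [/= Tt Jj ->] Pf ->]]].
  by exists tau, j, f.
move=> [tau [j [f [Tt Jj Pf ->]]]]; exists ((tau * phi j)%g, f); split => //=.
by apply/allpairsP; exists (tau, j).
Qed.

Lemma card_box_le J P : (#|` box J P| <= #|` T| * size J * #|` P|)%N.
Proof. by rewrite card_fseq (leq_trans (size_undup _))// !size_allpairs. Qed.

(** A single tau in T already gives distinct elements tau t^j i(f): applying rho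
    determines j, because the image of t in H has infinite order. *)
Lemma card_box_ge J P : uniq J -> (size J * #|` P| <= #|` box J P|)%N.
Proof.
move=> uJ; have [tau [_ [_ [tauT _]]]] := T_cover 1%g.
pose s := [seq (tau * phi j * i f)%g | j <- J, f <- P].
have -> : (size J * #|` P| = size s)%N by rewrite size_allpairs.
apply: uniq_leq_size; last first.
  by move=> _ /allpairsP[[j f] [/= Jj Pf ->]]; apply/boxP; exists tau, j, f.
apply: allpairs_uniq; [exact: uJ|exact: fset_uniq|].
move=> [j f] [j' f'] /= _ _.
rewrite -!mulgA => /mulgI E.
have [i_inj _ _] := exact_i_rho.
have jj' : j = j'.
  apply/eqP; rewrite -subr_eq0; apply/eqP/t_inf.
  have : rho (phi j) = rho (phi j').
    by have := congr1 rho E; rewrite !gmulfM !rho_kernel !mulg1.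
  by rewrite expgzD gmulfM expgzN group_morphV => ->; rewrite mulgV.
by move: E; rewrite jj' => /mulgI /i_inj ->.
Qed.

(** Conjugation by t^n carried over to F: the image of i is normal, so a
    conjugate of i x has a preimage, unique since i is injective. *)
Definition conj_by (n : int) (x : F) : F :=
  xget 1%g [set y | (i x * phi n = phi n * i y)%g].

Lemma conj_byE n x : (i x * phi n = phi n * i (conj_by n x))%g.
Proof.
by rewrite /conj_by; case: xgetP => [y -> //|/= no]; have [y /no] := kernel_conj (phi n) x.
Qed.

(** The infinite analogue T t^[-N, N] i(F) of a box. Its width N plays the part
    of a word length on G modulo i(F). *)
Definition strip (N : nat) : set G :=
  [set g | exists tau n f, [/\ tau \in T, `|n| <= N%:Z & g = (tau * phi n * i f)%g]].

Lemma strip_mono M N g : (M <= N)%N -> strip M g -> strip N g.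
Proof.
by move=> MN [tau [n [f [Tt nM gE]]]]; exists tau, n, f; split => //; lia.
Qed.

Lemma fset_sub_strip (K : {fset G}) : exists N, forall k, k \in K -> strip N k.
Proof.
have h g : exists n : nat, strip n g.
  have [tau [n [f [Tt ->]]]] := T_cover g.
  by exists `|n|%N, tau, n, f; split.
have [u hu] := choice h.
exists (\max_(k <- K) u k)%N => k kK.
have [tau [n [f [Tt nu ->]]]] := hu k.
exists tau, n, f; split => //; apply: le_trans nu _.
by rewrite lez_nat; exact: (leq_bigmax_seq (F := u)).
Qed.

(** Left multiplication by K widens a box by a constant c that depends on K
    only: write k tau = tau' t^n i(e) with |n| <= c and move i(e) past t^j. The
    conjugates of the finitely many e must be absorbed by P. *)
Lemma mul_box_sub (K : {fset G}) : exists (c : nat) (E : {fset F}),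
  forall (L : nat) (P : {fset F}),
  (forall e j f, e \in E -> j \in segment L -> f \in P ->
     (conj_by j e * f)%g \in P) ->
  {subset [fset (k * s)%g | k in K, s in box (segment L) P]%fset <=
    box (segment (L + c)) P}.
Proof.
have [c Kc] := fset_sub_strip [fset (k * s)%g | k in K, s in T]%fset.
have h g : exists f, (exists tau n,
    [/\ tau \in T, `|n| <= c%:Z & g = (tau * phi n * i f)%g]) \/ ~ strip c g.
  have [[tau [n [f [? ? ?]]]]|nb] := pselect (strip c g); last by exists 1%g; right.
  by exists f; left; exists tau, n.
have [e he] := choice h.
exists c, (e @` [fset (k * s)%g | k in K, s in T])%fset => L P PP x.
move=> /imfset2P[k kK [_ /boxP[tau [j [f [Tt Jj Pf ->]]]] ->]].
have ktK : (k * tau)%g \in [fset (k * s)%g | k in K, s in T]%fset by exact: in_imfset2.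
have [[tau' [n [Tt' nc ktE]]]|/(_ (Kc _ ktK))//] := he (k * tau)%g.
apply/boxP; exists tau', (n + j), (conj_by j (e (k * tau)%g) * f)%g; split => //.
- by move: Jj nc; rewrite !mem_zint; lia.
- by apply: PP => //; apply/imfsetP; exists (k * tau)%g.
- set y := e _ in ktE *; rewrite !mulgA ktE expgzD gmulfM !mulgA.
  by rewrite -(mulgA _ (i y) (phi j)) conj_byE !mulgA.
Qed.

(** By mul_box_sub, K S \ S lies over the two end intervals of length c, while S
    lies over an interval of length 2 L + 1, with the same T and P: the ratio of
    the cardinals tends to 0. *)
Lemma box_folner (R : realType) (K : {fset G}) (eps : R) : 0 < eps ->
  exists (L0 : nat) (E : {fset F}), forall (L : nat) (P : {fset F}),
  (L0 <= L)%N -> P != fset0 ->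
  (forall e j f, e \in E -> j \in segment L -> f \in P ->
     (conj_by j e * f)%g \in P) ->
  folner K eps (box (segment L) P).
Proof.
move=> eps0; have [c [E KE]] := mul_box_sub K.
exists (Num.bound ((#|` T| * (2 * c))%:R / eps)), E => L P L0L P0 PP.
have sub := KE L P PP.
set S := box _ P in sub *.
rewrite /folner.
set D := (_ `\` S)%fset.
have DS : (#|` D| <= #|` T| * (2 * c) * #|` P|)%N.
  (* J consists of the integers in [-(L + c), -L) and in (L, L + c]. *)
  pose J := zint (- (L + c)%:Z) c ++ zint (L.+1%:Z) c.
  apply: leq_trans (fsubset_leq_card (_ : (D `<=` box J P)%fset)) _.
    apply/fsubsetP => x; rewrite in_fsetD.
    move=> /andP[xS /sub /boxP[tau [j [f [Tt Jj Pf xE]]]]].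
    apply/boxP; exists tau, j, f; split => //; rewrite mem_cat.
    apply: contraNT xS => jJ; apply/boxP; exists tau, j, f; split => //.
    by move: Jj jJ; rewrite !mem_zint; lia.
  rewrite (leq_trans (card_box_le _ _))// size_cat !size_zint; lia.
have SL : ((2 * L).+1 * #|` P| <= #|` S|)%N.
  by rewrite -{1}(size_zint (- L%:Z) (2 * L).+1); apply: card_box_ge; exact: uniq_zint.
have P_gt0 : (0 < #|` P|)%N by rewrite cardfs_gt0.
apply: (@le_lt_trans _ _ ((#|` T| * (2 * c))%:R * #|` P|%:R)).
  by rewrite -natrM ler_nat.
apply: (@lt_le_trans _ _ (eps * ((2 * L).+1 * #|` P|)%:R)); last first.
  by rewrite ler_pM2l// ler_nat.
rewrite [X in _ < _ * X]natrM mulrA ltr_pM2r ?ltr0n//.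
rewrite [ltRHS]mulrC -ltr_pdivrMr//.
apply: (lt_le_trans (archi_boundP _)).
  by rewrite divr_ge0// ltW.
rewrite ler_nat; apply: leq_trans L0L _; lia.
Qed.

(** The length L is fixed first; the finitely many conjugates to be absorbed then
    generate a finite subgroup P of F. *)
Lemma locally_finite_folner (R : realType) (K : {fset G}) (eps : R) :
  locally_finite F -> 0 < eps -> exists S, folner K eps S.
Proof.
move=> lfF eps0; have [L [E KE]] := box_folner K eps0.
pose Q := [fset conj_by j e | j in segment L, e in E]%fset.
have /finite_fsetP[P gP] := lfF [set` Q] (finite_fset Q).
have gc : group_closed (mem (generated [set` Q])).
  split; first by apply/mem_set => A [[/set_mem A1 _] _].
  move=> x y /set_mem Px /set_mem Py; apply/mem_set => A sA.
  apply/set_mem; have [sgA _] := sA.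
  by apply: sgA.2; apply/mem_set; [apply: Px|apply: Py].
have PE x : (x \in P) = (x \in mem (generated [set` Q])).
  by rewrite gP; apply/idP/idP => [xP|/set_mem//]; apply/mem_set.
exists (box (segment L) P); apply: KE => //.
  by apply/fset0Pn; exists 1%g; rewrite PE gc.1.
move=> e j f eE jL; rewrite !PE; apply: (group_closedM gc).
apply/mem_set; apply: sub_gen_smallest => /=.
by apply/imfset2P; exists j => //; exists e.
Qed.

(** With F finite, one may take P = F for all L. A product s^-1 s' of two elements
    of S = T t^[-L, L] i(F) has width at most d + (c + 1) L: left multiplication
    by t widens a strip by c, right multiplication by t widens it by 1, and T^-1 T
    has width d. So S^-1 S is a box of length linear in L, like S. *)
Lemma folner_doubling : finite_set [set: F] -> exists C : nat,
  forall (R : realType) (K : {fset G}) (eps : R), 0 < eps ->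
  exists S, folner K eps S /\
    (#|` [fset (s^-1 * s')%g | s in S, s' in S]%fset| <= C * #|` S|)%N.
Proof.
move=> /finite_fsetP[P PT].
have inP f : f \in P by have : [set: F] f by []; rewrite PT.
have [c Kc] := fset_sub_strip [fset (phi n * s)%g | n in zint (-1) 3, s in T]%fset.
have [d Kd] := fset_sub_strip [fset (s^-1 * s')%g | s in T, s' in T]%fset.
have phi1_strip M n g : `|n| <= 1 -> strip M g -> strip (M + c) (phi n * g)%g.
  move=> n1 [tau [m [f [Tt mM ->]]]].
  have [|tau' [n' [f' [Tt' n'c E]]]] := Kc (phi n * tau)%g.
    by apply: in_imfset2 => //=; rewrite mem_zint; lia.
  exists tau', (n' + m), (conj_by m f' * f)%g; split => //; first by lia.
  by rewrite !mulgA E expgzD gmulfM !mulgA -(mulgA _ (i f') (phi m)) conj_byE !mulgA.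
have phi_strip M n g : strip M g -> strip (M + `|n| * c) (phi n * g)%g.
  move=> Mg.
  elim: n => [|n IH|n IH]; first by rewrite mul0n addn0 mul1g.
    rewrite -addn1 PoszD addrC expgzD -mulgA.
    have := phi1_strip _ 1 _ isT IH.
    by congr (strip _ _); lia.
  rewrite -addn1 PoszD opprD addrC expgzD -mulgA.
  have := phi1_strip _ (-1) _ isT IH.
  by congr (strip _ _); lia.
have strip_phi M n g : strip M g -> strip (M + `|n|) (g * phi n)%g.
  move=> [tau [m [f [Tt mM ->]]]]; exists tau, (m + n), (conj_by n f); split => //.
    by lia.
  by rewrite expgzD !mulgA -(mulgA _ (i f) (phi n)) conj_byE !mulgA.
have strip_i M f g : strip M g -> strip M (g * i f)%g.
  move=> [tau [m [f' [Tt mM ->]]]]; exists tau, m, (f' * f)%g; split => //.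
  by rewrite gmulfM !mulgA.
have i_strip M f g : strip M g -> strip M (i f * g)%g.
  by move=> Mg; have [f' ->] := kernel_conj g f; exact: strip_i.
exists (#|` T| * (2 * d + 2 * c + 3))%N => R K eps eps0.
have [L [E KE]] := box_folner K eps0.
set S := box (segment L) P.
exists S; split.
  by apply: KE => //; apply/fset0Pn; exists 1%g.
pose M := (d + L * c + L)%N.
have sub : ([fset (s^-1 * s')%g | s in S, s' in S] `<=` box (segment M) P)%fset.
  apply/fsubsetP => _ /imfset2P[s /boxP[tau [j [f [Tt Jj Pf ->]]]] [s' + ->]].
  move=> /boxP[tau' [j' [f' [Tt' Jj' Pf' ->]]]].
  have : strip M (i f^-1 * (phi (- j) * ((tau^-1 * tau') * phi j' * i f')))%g.
    apply: i_strip.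
    have : strip (d + L + L * c) (phi (- j) * ((tau^-1 * tau') * phi j' * i f'))%g.
      have jL : (`|- j|%N <= L)%N by move: Jj; rewrite mem_zint; lia.
      have j'L : (`|j'|%N <= L)%N by move: Jj'; rewrite mem_zint; lia.
      apply: strip_mono (phi_strip (d + L)%N (- j) _ _).
        by rewrite leq_add2l leq_mul2r jL orbT.
      apply: strip_i; apply: strip_mono (strip_phi d j' _ (Kd _ _)).
        by rewrite leq_add2l.
      exact: in_imfset2.
    by congr (strip _ _); rewrite /M; lia.
  move=> [tau2 [n [f2 [Tt2 nM E2]]]]; apply/boxP; exists tau2, n, f2; split => //.
    by rewrite mem_zint; lia.
  by rewrite -E2 group_morphV expgzN !invgM !mulgA.
apply: leq_trans (fsubset_leq_card sub) _.
apply: leq_trans (card_box_le _ _) _.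
rewrite size_zint.
have SL : ((2 * L).+1 * #|` P| <= #|` S|)%N.
  by rewrite -{1}(size_zint (- L%:Z) (2 * L).+1); apply: card_box_ge; exact: uniq_zint.
apply: (@leq_trans (#|` T| * (2 * d + 2 * c + 3) * ((2 * L).+1 * #|` P|))%N).
  rewrite -!mulnA leq_mul2l; apply/orP; right.
  by rewrite mulnA leq_mul2r; apply/orP; right; rewrite /M; nia.
by rewrite leq_mul2l SL orbT.
Qed.

End boxes.

(** * Borel measures from contents on the clopen sets *)

Lemma sigma_clopen (X : topologicalType) :
  (forall O : set X, open O ->
    exists2 C : nat -> set X, forall n, clopen (C n) & O = \bigcup_n C n) ->
  <<s @clopen X >> = <<s @open X >>.
Proof.
move=> openX; apply/seteqP.
split; apply: smallest_sub => //; try exact: smallest_sigma_algebra.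
  by move=> A [oA _]; exact: sub_gen_smallest.
move=> O /openX[C cC ->]; apply: sigma_algebra_bigcup => n.
exact: sub_gen_smallest.
Qed.

(** A copy of X that carries the algebra of its clopen sets, so that the
    extension theorem for measures on rings of sets applies to it. *)
Definition clopen_type (X : ptopologicalType) : Type := X.

Section clopen_algebra.
Variable X : ptopologicalType.

HB.instance Definition _ := Pointed.on (clopen_type X).
HB.instance Definition _ := isAlgebraOfSets.Build default_measure_display
  (clopen_type X) (@clopen0 X) (@clopenU X) (fun A => @clopenC X A set0).

End clopen_algebra.

Section content_extension.
Variables (R : realType) (X : ptopologicalType) (q : set X -> R).
Hypothesis cptX : compact [set: X].
Hypothesis openX : forall O : set X, open O ->
  exists2 C : nat -> set X, forall n, clopen (C n) & O = \bigcup_n C n.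
Hypothesis q_ge0 : forall A, 0 <= q A.
Hypothesis qT : q setT = 1.
Hypothesis qU : forall A B, clopen A -> clopen B -> A `&` B = set0 ->
  q (A `|` B) = q A + q B.

Let m (A : set (clopen_type X)) : \bar R := (q A)%:E.

Let m_ge0 A : (0 <= m A)%E.
Proof. by rewrite lee_fin. Qed.

Let q0 : q set0 = 0.
Proof.
have := qU (@clopen0 X) (@clopen0 X) (setI0 set0).
by rewrite setU0 => /eqP; rewrite addrC -subr_eq subrr => /eqP <-.
Qed.

Let m_semi_additive : measure_function.semi_additive m.
Proof.
move=> F n mF tF mU.
have cF k : clopen (\big[setU/set0]_(i < k) F i).
  by apply: (big_ind (@clopen X)) => *; [exact: clopen0|exact: clopenU|exact: mF].
elim: n {mU} => [|n IH]; first by rewrite !big_ord0 /m q0.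
rewrite !big_ord_recr/= -IH /m -EFinD; congr (_%:E).
apply: qU; [exact: cF|exact: mF|].
rewrite -bigcup_mkord; apply/seteqP; split => // x [[k /= kn Fkx] Fnx].
have kn' : k = n by apply: tF => //; exists x.
by rewrite kn' ltnn in kn.
Qed.

HB.instance Definition _ := isContent.Build default_measure_display
  (clopen_type X) R m m_ge0 m_semi_additive.

(** A clopen set covered by countably many clopen sets is covered by finitely many
    of them: finite additivity is enough. *)
Let m_sigma_subadditive : measurable_subset_sigma_subadditive m.
Proof.
move=> A F mF mA AF.
have cA : compact (A : set X) by apply: (subclosed_compact mA.2 cptX).
have [D _ AD] : finite_subset_cover setT (F : nat -> set X) A.
  by move: cA; rewrite compact_cover; apply => // n _; exact: (mF n).1.
pose N := (\max_(i <- D) i).+1.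
apply: (@le_trans _ _ (\sum_(k < N) m (F k))%E).
  apply: content_subadditive => // x /AD[k /= kD Fkx].
  rewrite -bigcup_mkord; exists k => //=.
  rewrite ltnS; exact: (leq_bigmax_seq (F := fun i : nat => i)).
by rewrite -(big_mkord xpredT (fun k => m (F k))); apply: nneseries_lim_ge.
Qed.

HB.instance Definition _ :=
  Content_SigmaSubAdditive_isMeasure.Build default_measure_display R
    (clopen_type X) m m_sigma_subadditive.

Let me : set (borel X) -> \bar R := measure_extension m.

Let me_clopen A : clopen A -> me A = (q A)%:E.
Proof. by move=> cA; rewrite /me /measure_extension measurable_mu_extE. Qed.

Let me0 : me set0 = 0%E. Proof. by rewrite me_clopen ?q0//; exact: clopen0. Qed.

Let me_ge0 A : (0 <= me A)%E. Proof. exact: measure_ge0. Qed.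

Let me_sigma_additive : semi_sigma_additive me.
Proof.
move=> F mF tF mUF; apply: (@measure_semi_sigma_additive _ _ _ (measure_extension m)) => //.
- by move=> n; have := mF n; rewrite /measurable/= (sigma_clopen openX).
- by move: mUF; rewrite /measurable/= (sigma_clopen openX).
Qed.

HB.instance Definition _ := isMeasure.Build _ (borel X) R me
  me0 me_ge0 me_sigma_additive.

Let me_setT : me setT = 1%E.
Proof. by rewrite me_clopen ?qT//; exact: clopenT. Qed.

HB.instance Definition _ := Measure_isProbability.Build _ (borel X) R me me_setT.

Lemma content_extension : exists mu : probability (borel X) R,
  forall A, clopen A -> mu A = (q A)%:E.
Proof. by exists me. Qed.

End content_extension.

(** The image of an ultrafilter contains each set or its complement, so a cluster
    point, which exists by compactness, is a limit. *)
Lemma ultra_cvg_segment (R : realType) (U : set_system nat) (u : nat -> R) (a b : R) :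
  UltraFilter U -> (forall n, a <= u n <= b) -> cvg (u @ U).
Proof.
move=> UU uab.
have PU : ProperFilter U by apply: ultra_proper.
have [c [_ cc]] : `[a, b]%classic `&` cluster (u @ U) !=set0.
  apply: (@segment_compact _ a b (u @ U)) => /=.
  by apply: filterE => n; rewrite /= in_itv/= uab.
apply/cvg_ex; exists c => V Vc /=.
have [//|UV] := in_ultra_setVsetC (u @^-1` V) UU.
by have [x [nVx Vx]] := cc (~` V) V UV Vc.
Qed.

Section limit_measure.
Variables (R : realType) (X : ptopologicalType).
Hypothesis cptX : compact [set: X].
Hypothesis openX : forall O : set X, open O ->
  exists2 C : nat -> set X, forall n, clopen (C n) & O = \bigcup_n C n.

(** Weak-* compactness of the space of probability measures, in the form needed
    below: the additive set functions p n have a limit along an ultrafilter, and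
    eventual inequalities between their values pass to it. *)
Lemma limit_measure (p : nat -> set X -> R) :
  (forall n A, clopen A -> 0 <= p n A <= 1) -> (forall n, p n setT = 1) ->
  (forall n A B, clopen A -> clopen B -> A `&` B = set0 ->
    p n (A `|` B) = p n A + p n B) ->
  exists mu : probability (borel X) R,
  (forall A B, clopen A -> clopen B ->
     (forall e, 0 < e -> \forall n \near \oo, p n A <= p n B + e) ->
     (mu A <= mu B)%E) /\
  (forall A c, clopen A -> (\forall n \near \oo, c <= p n A) -> (c%:E <= mu A)%E).
Proof.
move=> p01 pT padd.
have [U [UU sU]] := @ultraFilterLemma _ (\oo : set_system nat) _.
have PU : ProperFilter U by apply: ultra_proper.
(* Unlike p, the function p' is bounded on all sets, so its ultralimit exists. *)
pose p' n A := if `[< clopen A >] then p n A else 0.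
have p'E n A : clopen A -> p' n A = p n A by rewrite /p'; case: asboolP.
have p'01 n A : 0 <= p' n A <= 1.
  by rewrite /p'; case: asboolP => [/p01//|_]; rewrite lexx ler01.
have cvp A : cvg (p'^~ A @ U).
  by apply: (ultra_cvg_segment (a := 0) (b := 1)) => // n; exact: p'01.
pose q (A : set X) : R := lim (p'^~ A @ U).
have cvq A : p'^~ A @ U --> q A by exact: cvp.
have q_ge0 A : 0 <= q A.
  by apply: limr_ge; [exact: cvp|apply: nearW => n; case/andP: (p'01 n A)].
have qT : q setT = 1.
  rewrite /q; have -> : p'^~ setT = cst 1.
    by apply/funext => n; rewrite p'E ?pT//; exact: clopenT.
  exact: lim_cst.
have qadd A B : clopen A -> clopen B -> A `&` B = set0 -> q (A `|` B) = q A + q B.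
  move=> cA cB AB; apply: cvg_lim => //.
  have -> : p'^~ (A `|` B) = (fun n => p' n A + p' n B).
    by apply/funext => n; rewrite !p'E ?padd//; exact: clopenU.
  by apply: cvgD; exact: cvq.
have [mu muE] := content_extension cptX openX q_ge0 qT qadd.
exists mu; split=> [A B cA cB AB|A c cA cp].
  rewrite !muE// lee_fin; apply/ler_addgt0Pr => e e0.
  have pBe : (fun n => p' n B + e) @ U --> q B + e.
    by apply: cvgD; [exact: cvq|exact: cvg_cst].
  apply: (@ler_cvg_to _ U _ _ _ _ _ _ (cvq A) pBe).
  by apply: filterS (sU _ (AB _ e0)) => n; rewrite !p'E.
rewrite muE// lee_fin; apply: limr_ge; first exact: cvp.
by apply: filterS (sU _ cp) => n; rewrite p'E.
Qed.

End limit_measure.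

(** * Clopen sets, actions and castles *)

Section clopen_basis.
Variables (R : realType) (X : pmetricType R).
Hypothesis cantorX : is_cantor_set X.

Lemma cantor_compact : compact [set: X].
Proof.
have [f [cf [g [fK gK cg]]]] := cantorX.
have -> : [set: X] = f @` setT by apply/seteqP; split => // x _; exists (g x).
apply: continuous_compact; last exact: cantor_space_compact.
exact: continuous_subspaceT.
Qed.

Lemma clopen_nbhs (x : X) (O : set X) : nbhs x O ->
  exists C, [/\ clopen C, C x & C `<=` O].
Proof.
have [f [cf [g [fK gK cg]]]] := cantorX.
have zdX : zero_dimensional X.
  move=> y z yz; have [|U [cU Uy Uz]] := @cantor_zero_dimensional (g y) (g z).
    by apply: contra_neq yz => /(can_inj gK).
  by exists (g @^-1` U); split => //; exact: preimage_clopen.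
move=> /(zero_dimensional_cvg (@metric_hausdorff R X) zdX cantor_compact).
by move=> [C [Cx cC] CO]; exists C.
Qed.

Lemma open_bigcup_clopen (O : set X) : open O ->
  exists2 C : nat -> set X, forall n, clopen (C n) & O = \bigcup_n C n.
Proof.
move=> oO; have [e] := @clopen_surj R X cantor_compact.
have ce n : clopen (e n) by exact: (@funS _ _ _ _ e n).
pose C n := if `[< e n `<=` O >] then e n else set0.
exists C.
  by move=> n; rewrite /C; case: asboolP => _; [exact: ce|exact: clopen0].
apply/seteqP; split=> [x Ox|x [n _]]; last by rewrite /C; case: asboolP => // s /s.
have [D [cD Dx DO]] := clopen_nbhs (open_nbhs_nbhs (conj oO Ox)).
have [n _ en] := @surj _ _ _ _ e D cD.
by exists n => //; rewrite /C en; case: asboolP.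
Qed.

End clopen_basis.

Lemma clopen_bigcup (X : topologicalType) (K : choiceType) (D : {fset K})
  (f : K -> set X) : (forall k, k \in D -> clopen (f k)) ->
  clopen (\bigcup_(k in [set` D]) f k).
Proof.
move=> cf; rewrite bigcup_fset big_seq.
by apply: (big_ind (@clopen X)) => //; [exact: clopen0|exact: clopenU].
Qed.

Lemma set_index_enum (I : finType) : [set: I] = [set` index_enum I].
Proof. by apply/seteqP; split => // i _; rewrite /= mem_index_enum. Qed.

Section action_theory.
Variables (R : realType) (G : groupType) (X : pmetricType R) (a : action G X).

Lemma act_continuous s : continuous (a s).
Proof. by have [] := act_homeo a s. Qed.

Lemma actK s : cancel (a s) (a s^-1%g).
Proof. by move=> x; rewrite -actM mulVg act1. Qed.

Lemma actVK s : cancel (a s^-1%g) (a s).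
Proof. by move=> x; rewrite -actM mulgV act1. Qed.

Lemma image_act s (A : set X) : a s @` A = a s^-1%g @^-1` A.
Proof.
apply/seteqP; split=> [_ [x Ax <-]|x Ax]; first by rewrite /= actK.
by exists (a s^-1%g x); rewrite ?actVK.
Qed.

Lemma open_image_act s (A : set X) : open A -> open (a s @` A).
Proof.
move=> oA; rewrite image_act; apply: open_comp => // x _.
exact: act_continuous.
Qed.

Lemma clopen_image_act s (A : set X) : clopen A -> clopen (a s @` A).
Proof.
by move=> cA; rewrite image_act; apply: preimage_clopen => //; exact: act_continuous.
Qed.

Lemma open_measurable_borel (A : set X) : open A -> measurable (A : set (borel X)).
Proof. by move=> oA; exact: sub_gen_smallest. Qed.

Lemma clopen_measurable_borel (A : set X) : clopen A -> measurable (A : set (borel X)).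
Proof. by case=> oA _; exact: open_measurable_borel. Qed.

Lemma closed_measurable_borel (A : set X) : closed A -> measurable (A : set (borel X)).
Proof.
move=> cA; rewrite -(setCK A); apply: measurableC; apply: open_measurable_borel.
exact: closed_openC.
Qed.

Lemma displaced_nbhs s x : a s x <> x ->
  exists2 O, nbhs x O & (a s @` O) `&` O = set0.
Proof.
move=> sx; have := @metric_hausdorff R X; rewrite open_hausdorff => /(_ (a s x) x).
move=> /(_ (introN eqP sx))[[U V] [/= /set_mem Usx /set_mem Vx] [oU oV /eqP UV]].
exists (V `&` a s @^-1` U).
  apply: filterI; first exact: open_nbhs_nbhs.
  by apply: act_continuous; exact: open_nbhs_nbhs.
apply/seteqP; split => // _ [[y [_ Uy] <-] [Vy _]].
by rewrite -UV.
Qed.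

Lemma closed_fixed_points s : closed (fixed_points a s).
Proof.
rewrite -(setCK (fixed_points a s)); apply: open_closedC.
rewrite openE => x /displaced_nbhs[U Ux sU].
apply: filterS Ux => y Uy /= sy; suff : set0 y by [].
by rewrite -sU; split => //; exists y.
Qed.

Lemma diam_le (A : set X) x (e : R) : 0 <= e -> A `<=` ball x e -> (diam A <= (e + e)%:E)%E.
Proof.
move=> e0 Ae; apply: ge_ereal_sup => _ [->|[y Ay [z Az <-]]].
  by rewrite lee_fin addr_ge0.
rewrite lee_fin; have := Ae _ Ay; have := Ae _ Az; rewrite ballEmdist/= => zx yx.
apply: le_trans (metric_triangle y x z) _.
by rewrite lerD ?ltW// metric_sym.
Qed.

Lemma diamS (A B : set X) : A `<=` B -> (diam A <= diam B)%E.
Proof.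
move=> AB; apply: ereal_sup_le; apply: setUS => _ [x Ax [y Ay <-]].
by exists x; [exact: AB|exists y => //; exact: AB].
Qed.

Lemma measurable_act s : measurable_fun setT (a s : borel X -> borel X).
Proof.
apply: (@measurability _ _ (borel X) (borel X) setT (a s) (@open X) erefl).
move=> _ [A oA <-]; rewrite setTI.
by apply: open_measurable_borel; apply: open_comp => // x _; exact: act_continuous.
Qed.

(** The clopen sets form a pi-system that generates the Borel sets, and applying
    the inequality to s and to s^-1 gives the equality. *)
Lemma clopen_invariant (mu : probability (borel X) R) : is_cantor_set X ->
  (forall s A, clopen A -> (mu (a s @^-1` A) <= mu A)%E) ->
  invariant_measures a mu.
Proof.
move=> cX muA s A mA.
have clE B : clopen B -> mu (a s @^-1` B) = mu B.
  move=> cB; apply/eqP; rewrite eq_le muA//=.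
  have := muA s^-1%g (a s @^-1` B); rewrite -comp_preimage.
  have -> : a s \o a s^-1%g = id by apply/funext => x /=; rewrite actVK.
  by rewrite preimage_id; apply; apply: preimage_clopen => //; exact: act_continuous.
have mpre B : measurable (B : set (borel X)) -> measurable (a s @^-1` B : set (borel X)).
  by move=> mB; rewrite -[X in measurable X]setTI; exact: measurable_act.
apply: (@dynkin_induction _ (borel X) (@clopen X) (fun B => mu (a s @^-1` B) = mu B)).
- by rewrite sigma_clopen//; exact: open_bigcup_clopen.
- exact: clopenI.
- by rewrite preimage_setT.
- by move=> B /clE.
- by move=> B mB muB; rewrite preimage_setC !probability_setC ?muB//; exact: mpre.
- move=> F mF tF muF; rewrite preimage_bigcup !measure_bigcup//.
  + by apply: eq_eseriesr => n _; exact: muF.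
  + by move=> n _; exact: mpre.
  + move=> n m _ _ [x [Fn Fm]]; apply: tF => //; by exists (a s x).
- by rewrite sigma_clopen//; exact: open_bigcup_clopen.
Qed.

(** The translates of the bases by the elements of K S_i outside S_i. Every point
    k x with k in K and x in the footprint lies in the footprint or in this set. *)
Definition boundary (I : finType) (K : {fset G}) (S : I -> {fset G})
    (B : I -> set X) : set X :=
  \bigcup_(i in [set: I])
    \bigcup_(r in [set` ([fset (k * s)%g | k in K, s in S i] `\` S i)%fset])
      (a r @` B i).

Lemma open_boundary (I : finType) (K : {fset G}) (S : I -> {fset G}) (B : I -> set X) :
  (forall i, open (B i)) -> open (boundary K S B).
Proof.
move=> oB; apply: bigcup_open => i _; apply: bigcup_open => s _.
exact: open_image_act.
Qed.

Lemma open_footprint (I : finType) (S : I -> {fset G}) (B : I -> set X) :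
  (forall i, open (B i)) -> open (footprint a S B).
Proof.
move=> oB; apply: bigcup_open => i _; apply: bigcup_open => s _.
exact: open_image_act.
Qed.

Lemma clopen_footprint (I : finType) (S : I -> {fset G}) (B : I -> set X) :
  (forall i, clopen (B i)) -> clopen (footprint a S B).
Proof.
move=> cB; split; first by apply: open_footprint => i; exact: (cB i).1.
apply: closed_bigcup => [|i _]; first exact: finite_finset.
apply: closed_bigcup => // s _.
exact: (clopen_image_act s (cB i)).2.
Qed.

Section invariant_measure.
Variable mu : probability (borel X) R.
Hypothesis mu_inv : invariant_measures a mu.

Lemma measure_image_act s (A : set X) : measurable (A : set (borel X)) ->
  mu (a s @` A) = mu A.
Proof. by move=> mA; rewrite image_act mu_inv. Qed.

Lemma tower_measure (S : {fset G}) (B : set X) : open B -> tower a S B ->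
  mu (\bigcup_(s in [set` S]) (a s @` B)) = (#|` S|%:R%:E * mu B)%E.
Proof.
move=> oB tB; rewrite measure_fin_bigcup//; last first.
  by move=> s _; apply: open_measurable_borel; exact: open_image_act.
rewrite -fsbig_seq ?fset_uniq//.
rewrite (eq_bigr (fun=> mu B)); last first.
  by move=> s _; apply: measure_image_act; exact: open_measurable_borel.
by rewrite big_const_seq count_predT iter_addr_0 mule_natl.
Qed.

Lemma castle_measure (I : finType) (S : I -> {fset G}) (B : I -> set X) :
  (forall i, open (B i)) -> castle a S B ->
  mu (footprint a S B) = (\sum_i #|` S i|%:R%:E * mu (B i))%E.
Proof.
move=> oB [tB dB]; rewrite /footprint measure_fin_bigcup//; first last.
- move=> i _; apply: fin_bigcup_measurable => // s _.
  by apply: open_measurable_borel; exact: open_image_act.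
- move=> i j _ _ [x [[s Ss sx] [t St tx]]]; apply/eqP/negPn/negP => ij.
  have : (a s @` B i `&` a t @` B j) x by split.
  by rewrite dB.
- exact: finite_finset.
rewrite set_index_enum -fsbig_seq ?index_enum_uniq//.
by apply: eq_bigr => i _; exact: tower_measure.
Qed.

Lemma translates_measure_le (D : {fset G}) (B : set X) : open B ->
  (mu (\bigcup_(s in [set` D]) (a s @` B)) <= #|` D|%:R%:E * mu B)%E.
Proof.
move=> oB.
have mB s : measurable (a s @` B : set (borel X)).
  by apply: open_measurable_borel; exact: open_image_act.
apply: le_trans (content_sub_fsum (A_ := fun s => a s @` B : set (borel X))
  mu _ _ _ (@subset_refl _ _)) _ => //.
  exact: fin_bigcup_measurable.
rewrite -fsbig_seq ?fset_uniq// (eq_bigr (fun=> mu B)); last first.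
  by move=> s _; apply: measure_image_act; exact: open_measurable_borel.
by rewrite big_const_seq count_predT iter_addr_0 mule_natl.
Qed.

(** Each tower contributes at most |K S_i \ S_i| mu(B_i) <= delta |S_i| mu(B_i),
    and the sum of the |S_i| mu(B_i) is the measure of the footprint. *)
Lemma boundary_measure_le (I : finType) (S : I -> {fset G}) (B : I -> set X)
    (K : {fset G}) (delta : R) : 0 < delta ->
  (forall i, open (B i)) -> castle a S B -> (forall i, folner K delta (S i)) ->
  (mu (boundary K S B) <= delta%:E)%E.
Proof.
move=> delta0 oB cSB fS; have mB i s : measurable (a s @` B i : set (borel X)).
  by apply: open_measurable_borel; exact: open_image_act.
pose D i := ([fset (k * s)%g | k in K, s in S i] `\` S i)%fset.
have mD i : measurable (\bigcup_(r in [set` D i]) (a r @` B i) : set (borel X)).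
  exact: fin_bigcup_measurable.
apply: le_trans (content_sub_fsum (D := setT)
  (A_ := fun i => \bigcup_(r in [set` D i]) (a r @` B i) : set (borel X))
  mu _ _ _ (@subset_refl _ _)) _ => //.
- exact: finite_finset.
- by apply: fin_bigcup_measurable => //; exact: finite_finset.
rewrite set_index_enum -fsbig_seq ?index_enum_uniq//.
apply: (@le_trans _ _ (\sum_i delta%:E * (#|` S i|%:R%:E * mu (B i)))%E).
  apply: lee_sum => i _; apply: le_trans (translates_measure_le _ (oB i)) _.
  rewrite muleA -EFinM lee_wpmul2r ?measure_ge0// lee_fin ltW//.
  exact: fS.
rewrite -ge0_sume_distrr; last by move=> i _; rewrite mule_ge0// lee_fin.
rewrite -castle_measure// -[leRHS]mule1; apply: lee_wpmul2l.
  by rewrite lee_fin ltW.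
apply: probability_le1; apply: fin_bigcup_measurable; first exact: finite_finset.
by move=> i _; exact: fin_bigcup_measurable.
Qed.

Lemma sup_measure_ge (A : set X) : (mu A <= sup_measure a A)%E.
Proof. by apply: ereal_sup_ubound; exists mu. Qed.

Lemma essentially_free_null s : essentially_free a -> s != 1%g ->
  mu (fixed_points a s) = 0%E.
Proof.
move=> ef s1; apply/eqP; rewrite eq_le measure_ge0 andbT -(ef s s1).
exact: sup_measure_ge.
Qed.

End invariant_measure.

End action_theory.

(** * Limits of measures *)

Section compactness.
Variables (R : realType) (G : groupType) (X : pmetricType R) (a : action G X).
Hypothesis cantorX : is_cantor_set X.

Lemma measure_act_preimage (mu : probability (borel X) R) s (A : set X) :
  invariant_measures a mu -> clopen A -> mu (a s @^-1` A) = mu A.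
Proof. by move=> inv cA; apply: inv; exact: clopen_measurable_borel. Qed.

(** Otherwise E is the intersection of decreasing clopen sets U n, each of measure
    more than eta for some invariant nu n. A limit of the nu n is invariant and
    gives measure at least eta to each U n, hence to E. *)
Lemma small_clopen_nbhd (E : set X) (eta : R) : closed E -> 0 < eta ->
  (forall mu, invariant_measures a mu -> mu E = 0%E) ->
  exists U, [/\ clopen U, E `<=` U &
    forall mu, invariant_measures a mu -> (mu U <= eta%:E)%E].
Proof.
move=> cE eta0 muE; apply: contrapT => noU.
have [C cC EC] := open_bigcup_clopen cantorX (closed_openC cE).
pose U n := ~` (\big[setU/set0]_(k < n) C k).
have cU n : clopen (U n).
  apply: (clopenC set0); apply: (big_ind (@clopen X)) => //.
  + exact: clopen0.
  + exact: clopenU.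
have EU n : E `<=` U n.
  by apply: subsetCr; rewrite EC -bigcup_mkord; apply: bigcup_sub => k _; exact: bigcup_sup.
have UE : \bigcap_n U n = E.
  apply/seteqP; split => [x Ux|x Ex n _]; last exact: EU.
  apply: contrapT => nEx; have : (~` E) x by [].
  rewrite EC => -[k _ Ckx]; have := Ux k.+1 I.
  by apply; rewrite -bigcup_mkord; exists k => /=.
have Udec m n : (m <= n)%N -> U n `<=` U m.
  by move=> mn; apply: subsetC; exact: subset_bigsetU.
have ex n : exists mu, invariant_measures a mu /\ (eta%:E < mu (U n))%E.
  apply: contrapT => no; apply: noU; exists (U n); split => // mu inv.
  by rewrite leNgt; apply/negP => lt; apply: no; exists mu.
have [nu nuP] := choice ex.
have fin n A : clopen A -> nu n A \is a fin_num.
  by move=> cA; apply: fin_num_measure; exact: clopen_measurable_borel.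
have [||n A B cA cB AB|mu [mu_le mu_ge]] :=
  limit_measure (cantor_compact cantorX) (@open_bigcup_clopen _ _ cantorX)
    (p := fun n A => fine (nu n A)).
- move=> n A cA; rewrite fine_ge0 ?measure_ge0//= -lee_fin fineK ?fin//.
  by apply: probability_le1; exact: clopen_measurable_borel.
- by move=> n; rewrite probability_setT.
- rewrite measureU ?fineD//; by [exact: fin|exact: clopen_measurable_borel].
have inv : invariant_measures a mu.
  apply: clopen_invariant => // s A cA; apply: mu_le => //.
    by apply: preimage_clopen => //; exact: act_continuous.
  move=> e e0; apply: nearW => n; rewrite measure_act_preimage ?lerDl ?ltW//.
  exact: (nuP n).1.
have muU n : (eta%:E <= mu (U n))%E.
  apply: mu_ge => //; exists n => // m /= nm.
  rewrite -lee_fin fineK ?fin//; apply: le_trans (ltW (nuP m).2) _.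
  by apply: le_measure; rewrite ?inE; [exact: clopen_measurable_borel|
    exact: clopen_measurable_borel|exact: Udec].
have : mu \o U @ \oo --> mu (\bigcap_n U n).
  apply: nonincreasing_cvg_mu.
  - by rewrite ltey_eq fin_num_measure//; exact: clopen_measurable_borel.
  - by move=> n; exact: clopen_measurable_borel.
  - by rewrite UE; exact: closed_measurable_borel.
  - by move=> m n mn; apply/subsetPset; exact: Udec.
rewrite UE muE// => cv0.
have : (eta%:E <= 0)%E.
  rewrite -(cvg_lim _ cv0)//; apply: lime_ge; first by apply/cvg_ex; exists 0%E.
  exact: nearW.
by rewrite lee_fin leNgt eta0.
Qed.

(** The theorem of Krylov and Bogoliubov: a limit of the averages of a point mass
    over S n is invariant if S n is Folner relatively to finite sets that exhaust
    G. *)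
Lemma folner_invariant_measure : countable [set: G] ->
  (forall (K : {fset G}) (eps : R), 0 < eps -> exists S, folner K eps S) ->
  exists mu, invariant_measures a mu.
Proof.
move=> /countable_injP[e e_inj] fol.
have finK n : finite_set (e @^-1` `I_n).
  by apply: finite_preimage => // x y _ _; apply: e_inj; rewrite inE.
have inv_gt0 n : 0 < n.+1%:R^-1 :> R by rewrite invr_gt0.
have [S folS] := choice (fun n => fol (fset_set (e @^-1` `I_n)) _ (inv_gt0 n)).
have S_gt0 n : 0 < (#|` S n|)%:R :> R.
  rewrite ltr0n lt0n; apply/eqP => S0; have := folS n.
  by rewrite /folner S0 mulr0 ltNge ler0n.
pose f (A : set X) (s : G) : R := \1_A (a s point).
have f01 A s : 0 <= f A s <= 1 by rewrite /f indicE ler0n lern1 leq_b1.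
pose p n (A : set X) : R := (\sum_(s <- S n) f A s) / (#|` S n|)%:R.
have [||n A B cA cB AB|mu [mu_le _]] :=
  limit_measure (cantor_compact cantorX) (@open_bigcup_clopen _ _ cantorX) (p := p).
- move=> n A _; apply/andP; split; rewrite /p.
    by rewrite divr_ge0// sumr_ge0// => s _; case/andP: (f01 A s).
  rewrite ler_pdivrMr// mul1r -sum1_fset; apply: ler_sum => s _.
  by case/andP: (f01 A s).
- move=> n; rewrite /p (eq_bigr (fun=> 1)); last by move=> s _; rewrite /f indicT.
  by rewrite sum1_fset divff// gt_eqF.
- rewrite /p -mulrDl -big_split/=; congr (_ / _); apply: eq_bigr => s _.
  rewrite /f !indicE in_setU; have [sA|_] := boolP (_ \in A); last by rewrite add0r.
  have [sB|_] := boolP (_ \in B); last by rewrite addr0.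
  by move: AB => /seteqP[/(_ (a s point)) + _]; case; split; exact: set_mem.
exists mu; apply: clopen_invariant => // s A cA; apply: mu_le => //.
  by apply: preimage_clopen => //; exact: act_continuous.
move=> eps eps0; near=> n.
have sK : s \in fset_set (e @^-1` `I_n).
  by rewrite in_fset_set// inE /=; near: n; exact: nbhs_infty_gt.
apply: (@le_trans _ _ (p n A + n.+1%:R^-1)); last first.
  rewrite lerD2l ltW//; near: n; exact: (near_infty_natSinv_lt (PosNum eps0)).
rewrite /p ler_pdivrMr// mulrDl divfK ?gt_eqF//.
have -> : \sum_(r <- S n) f (a s @^-1` A) r = \sum_(r <- S n) f A (s * r)%g.
  by apply: eq_bigr => r _; rewrite /f !indicE actM; congr (_%:R); apply/idP/idP; rewrite !inE.
apply: le_trans (ler_sum_translate (S n) sK (f01 A)) _.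
by rewrite lerD2l ltW//; exact: folS.
Unshelve. all: end_near. Qed.

End compactness.

(** * Almost finiteness in measure implies essential freeness *)

Section free_actions.
Variables (R : realType) (G : groupType) (X : pmetricType R) (a : action G X).

(** If x = t b is fixed by s, then also x = (s t) b; as the levels of a tower are
    disjoint, s t is outside of its shape. *)
Lemma fixed_points_sub (I : finType) (S : I -> {fset G}) (B : I -> set X) s :
  castle a S B -> s != 1%g ->
  fixed_points a s `<=` ~` footprint a S B `|` boundary a [fset s]%fset S B.
Proof.
move=> [tB _] s1 x sx; have [[i _ [t St tx]]|] := pselect (footprint a S B x); last by left.
right; have [b Bb btx] := tx.
have stb : a (s * t)%g b = x by rewrite actM btx.
exists i => //; exists (s * t)%g; last by exists b.
rewrite /= in_fsetD in_imfset2 ?inE ?andbT//; apply/negP => Sst.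
have : (s * t)%g = t by apply: (tB i) => //; exists x; split => //; exists b.
by move=> /(congr1 (fun g => (g * t^-1)%g)); rewrite mulgK mulgV => /eqP; exact/negP.
Qed.

Lemma almost_finite_essentially_free : (exists mu, invariant_measures a mu) ->
  almost_finite_in_measure a -> essentially_free a.
Proof.
move=> [mu0 inv0] af s s1; apply/eqP; rewrite eq_le; apply/andP; split; last first.
  by apply: le_trans (sup_measure_ge inv0 _); exact: measure_ge0.
apply: ge_ereal_sup => _ [mu inv <-].
apply/lee_addgt0Pr => e e0; rewrite add0e.
have e20 : 0 < e / 2 by rewrite divr_gt0.
have [I [S [B [[cSB oB] fS _ supS]]]] := af [fset s]%fset _ e20.
have mfix : measurable (fixed_points a s : set (borel X)).
  by apply: closed_measurable_borel; exact: closed_fixed_points.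
have mfoot : measurable (~` footprint a S B : set (borel X)).
  by apply: measurableC; apply: open_measurable_borel; exact: open_footprint.
have mbd : measurable (boundary a [fset s]%fset S B : set (borel X)).
  by apply: open_measurable_borel; exact: open_boundary.
apply: le_trans (_ : (_ <= mu (~` footprint a S B `|` boundary a [fset s]%fset S B))%E) _.
  by apply: le_measure; rewrite ?inE//; [exact: measurableU|exact: fixed_points_sub].
apply: le_trans (measureU2 _ _ _) _ => //.
rewrite [e]splitr EFinD; apply: leeD.
  by apply: le_trans (sup_measure_ge inv _) (ltW supS).
exact: boundary_measure_le.
Qed.

End free_actions.

(** * Exhausting a space by castles *)

Section markers.
Variables (R : realType) (G : groupType) (X : pmetricType R) (a : action G X).
Variables (A : set X) (V : nat -> set X) (W : {fset G}).
Hypothesis W1 : 1%g \in W.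
Hypothesis WV : forall g, g \in W -> g^-1%g \in W.
Hypothesis V_free : forall n g, g \in W -> g != 1%g -> (a g @` V n) `&` V n = set0.
Hypothesis cA : clopen A.
Hypothesis cV : forall n, clopen (V n).

(** Greedy choice of a maximal subset of A with disjoint translates: the points of
    A in V n that are not within W of the points chosen before. Since V n meets
    none of its own translates by W, all these points can be added at once. *)
Definition fresh (M : set X) (n : nat) : set X :=
  (A `&` V n) `\` \bigcup_(g in [set` W]) (a g @` M).

Fixpoint markers (n : nat) : set X :=
  if n is m.+1 then markers m `|` fresh (markers m) m else set0.

Lemma clopen_fresh M n : clopen M -> clopen (fresh M n).
Proof.
move=> cM; rewrite /fresh setDE; apply: clopenI; first exact: clopenI.
by apply: (clopenC set0); apply: clopen_bigcup => g _; exact: clopen_image_act.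
Qed.

Lemma clopen_markers n : clopen (markers n).
Proof.
elim: n => [|n IH] /=; first exact: clopen0.
by apply: clopenU => //; exact: clopen_fresh.
Qed.

Lemma markers_sub n : markers n `<=` A.
Proof. by elim: n => [//|n IH] x /= [/IH//|[[]]]. Qed.

Lemma markers_mono m n : (m <= n)%N -> markers m `<=` markers n.
Proof.
move=> /subnK <-; elim: (n - m)%N => [//|k IH].
by rewrite addSn /=; apply: subset_trans IH _; exact: subsetUl.
Qed.

Lemma fresh_sub m n : (m < n)%N -> fresh (markers m) m `<=` markers n.
Proof. by move=> /markers_mono; apply: subset_trans; exact: subsetUr. Qed.

Lemma markers_bigcup k :
  markers k = \bigcup_(j in [set: 'I_k]) fresh (markers j) j.
Proof.
apply/seteqP; split => [x|x [j _ xj]]; last exact: fresh_sub xj.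
elim: k => [//|k IH] [/IH[j _ xj]|xk]; last by exists ord_max.
by exists (widen_ord (leqnSn k) j).
Qed.

Lemma fresh_disjoint m n x : fresh (markers m) m x -> fresh (markers n) n x -> m = n.
Proof.
wlog mn : m n / (m <= n)%N.
  by move=> th xm xn; have [/th|/ltnW/th h] := leqP m n; [exact|apply/esym/h].
move: mn; rewrite leq_eqVlt => /orP[/eqP//|mn] xm [_ []].
exists 1%g => //; exists x; last by rewrite act1.
exact: fresh_sub xm.
Qed.

(** A new point is not in W M for the set M of the old points, and W = W^-1
    excludes that an old point be in W times a new one. *)
Lemma markers_separated n g : g \in W -> g != 1%g ->
  (a g @` markers n) `&` markers n = set0.
Proof.
move=> gW g1; elim: n => [|n IH]; first by rewrite setI0.
apply/seteqP; split => // _ [[x /= xM <-]] /=.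
case: xM => [xM|[[Ax Vx] xW]] [gxM|[[Agx Vgx] gxW]].
- suff : set0 (a g x) by [].
  by rewrite -IH; split => //; exists x.
- by apply: gxW; exists g => //; exists x.
- apply: xW; exists g^-1%g; first exact: WV.
  by exists (a g x) => //; rewrite actK.
- suff : set0 (a g x) by [].
  by rewrite -(V_free n gW g1); split => //; exists x.
Qed.

Lemma markers_cover k n : (k < n)%N ->
  A `&` V k `<=` \bigcup_(g in [set` W]) (a g @` markers n).
Proof.
move=> kn x AVx.
have [[g gW [y yM yx]]|xW] := pselect ((\bigcup_(g in [set` W]) (a g @` markers k)) x).
  by exists g => //; exists y => //; apply: markers_mono yM; exact: ltnW.
exists 1%g => //; exists x; last by rewrite act1.
by apply: (fresh_sub kn).
Qed.

End markers.

Section extend_castle.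
Variables (R : realType) (G : groupType) (X : pmetricType R) (a : action G X).
Variables (I : finType) (S : I -> {fset G}) (B : I -> set X).
Variables (S0 : {fset G}) (k : nat) (N : 'I_k -> set X).
Hypothesis cSB : castle a S B.
Hypothesis N_inj : forall s t j l x y, s \in S0 -> t \in S0 -> N j x -> N l y ->
  a s x = a t y -> s = t /\ j = l.
Hypothesis N_new : forall s j x, s \in S0 -> N j x -> ~ footprint a S B (a s x).

Definition extend_shape (x : I + 'I_k) := match x with inl i => S i | inr _ => S0 end.
Definition extend_base (x : I + 'I_k) := match x with inl i => B i | inr j => N j end.

Lemma extend_castle : castle a extend_shape extend_base.
Proof.
have [tB dB] := cSB; split=> [[i|j]|[i|j] [i'|j'] s t /= sS tS ij].
- exact: tB.
- by move=> s t /= sS tS [_ [[x Nx <-] [y Ny /esym /(N_inj sS tS Nx Ny)[]]]].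
- by apply: dB => //; apply: contra_neq ij => ->.
- apply/seteqP; split => // _ [[x Bx <-] [y Ny yx]].
  by apply: (N_new tS Ny); rewrite yx; exists i => //; exists s => //; exists x.
- apply/seteqP; split => // _ [[y Ny <-] [x Bx yx]].
  by apply: (N_new sS Ny); rewrite -yx; exists i' => //; exists t => //; exists x.
- apply/seteqP; split => // _ [[x Nx <-] [y Ny /esym /(N_inj sS tS Nx Ny)[_ jj']]].
  by rewrite jj' eqxx in ij.
Qed.

Lemma extend_footprint : footprint a extend_shape extend_base =
  footprint a S B `|` \bigcup_(s in [set` S0]) (a s @` (\bigcup_(j in [set: 'I_k]) N j)).
Proof.
apply/seteqP; split => x.
  move=> [[i|j] _ [s /= sS [y By <-]]].
    by left; exists i => //; exists s => //; exists y.
  by right; exists s => //; exists y => //; exists j.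
case=> [[i _ [s sS sx]]|[s sS [y [j _ Ny] <-]]].
  by exists (inl i) => //; exists s.
by exists (inr j) => //; exists s => //; exists y.
Qed.

End extend_castle.

Section exhaustion.
Variables (R : realType) (G : groupType) (X : pmetricType R) (a : action G X).
Hypothesis cantorX : is_cantor_set X.
Hypothesis free_ae : forall s mu, s != 1%g -> invariant_measures a mu ->
  mu (fixed_points a s) = 0%E.

Lemma fixed_points_bigcup_null (W : {fset G}) mu : invariant_measures a mu ->
  mu (\bigcup_(g in [set` (W `\ 1%g)%fset]) fixed_points a g) = 0%E.
Proof.
move=> inv; apply/eqP; rewrite eq_le measure_ge0 andbT.
have mfix g : measurable (fixed_points a g : set (borel X)).
  by apply: closed_measurable_borel; exact: closed_fixed_points.
apply: le_trans (content_sub_fsum (A_ := fun g => fixed_points a g : set (borel X))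
  mu _ _ _ (@subset_refl _ _)) _ => //.
  exact: fin_bigcup_measurable.
rewrite fsbig1// => g /=; rewrite in_fsetD1 => /andP[g1 _].
exact: free_ae.
Qed.

Lemma free_clopen_nbhd (W S : {fset G}) (x : X) (eps : R) : 0 < eps ->
  (forall g, g \in W -> g != 1%g -> a g x <> x) ->
  exists V, [/\ clopen V, V x,
    forall g, g \in W -> g != 1%g -> (a g @` V) `&` V = set0 &
    forall s, s \in S -> (diam (a s @` V) < eps%:E)%E].
Proof.
move=> eps0 free.
have exU g : exists U, nbhs x U /\ (g \in W -> g != 1%g -> (a g @` U) `&` U = set0).
  have [[gW g1]|no] := pselect (g \in W /\ g != 1%g).
    by have [U Ux gU] := displaced_nbhs (free g gW g1); exists U.
  by exists setT; split=> [|gW g1]; [exact: filterT|case: no].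
have [U UP] := choice exU.
have e30 : 0 < eps / 3 by rewrite divr_gt0.
have [|V [cV Vx VU]] := clopen_nbhs cantorX (x := x)
    (O := (\bigcap_(g in [set` W]) U g) `&`
          (\bigcap_(s in [set` S]) (a s @^-1` ball (a s x) (eps / 3)))).
  apply: filterI; apply: filter_bigI => g _; first exact: (UP g).1.
  by apply: act_continuous; exact: nbhsx_ballx.
exists V; split => // [g gW g1|s sS].
  have := (UP g).2 gW g1; rewrite -!subset0; apply: subset_trans.
  apply: setISS; last by move=> y /VU[/(_ g gW)].
  by apply: image_subset => y /VU[/(_ g gW)].
apply: (@le_lt_trans _ _ (eps / 3 + eps / 3)%:E); last by rewrite lte_fin; lra.
apply: (@diam_le _ _ _ (a s x)); first exact: ltW.
by move=> _ [y /VU[_ /(_ s sS) Vy] <-].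
Qed.

(** Compactness of the complement of U reduces the local statement
    free_clopen_nbhd to finitely many points. The sets V n are given for all n,
    with repetitions beyond k, so that they can feed the greedy choice. *)
Lemma free_clopen_cover (W S : {fset G}) (U : set X) (eps : R) :
  0 < eps -> clopen U ->
  (forall g x, g \in W -> g != 1%g -> a g x = x -> U x) ->
  exists (k : nat) (V : nat -> set X), [/\ forall n, clopen (V n),
    forall n g, g \in W -> g != 1%g -> (a g @` V n) `&` V n = set0,
    forall n s, s \in S -> (diam (a s @` V n) < eps%:E)%E &
    ~` U `<=` \bigcup_(j in [set: 'I_k]) V j].
Proof.
move=> eps0 cU fixU.
have exV x : exists V, [/\ clopen V, ~ U x -> V x,
    forall g, g \in W -> g != 1%g -> (a g @` V) `&` V = set0 &
    forall s, s \in S -> (diam (a s @` V) < eps%:E)%E].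
  have [Ux|nUx] := pselect (U x).
    exists set0; split => //; [exact: clopen0|by move=> *; rewrite setI0|move=> s _].
    rewrite image_set0; apply: (@le_lt_trans _ _ (0 + 0)%:E); last by rewrite lte_fin addr0.
    by apply: (@diam_le _ _ _ point) => //; exact: sub0set.
  have [|V [cV Vx gV dV]] := free_clopen_nbhd (x := x) (W := W) S eps0.
    by move=> g gW g1 gx; exact: nUx (fixU g x gW g1 gx).
  by exists V.
have [f fP] := choice exV.
have [D _ cov] : finite_subset_cover setT f (~` U).
  have : compact (~` U).
    by apply: (subclosed_compact _ (cantor_compact cantorX)) => //; exact: open_closedC cU.1.
  rewrite compact_cover; apply=> [x _|x nUx]; first by have [[]] := fP x.
  by exists x => //; have [_ + _ _] := fP x; exact.
exists (size D), (fun n => f (nth point D n)); split.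
- by move=> n; have [] := fP (nth point D n).
- by move=> n; have [] := fP (nth point D n).
- by move=> n; have [] := fP (nth point D n).
move=> y /cov[x xD fxy].
have kD : (index x D < size D)%N by rewrite index_mem.
by exists (Ordinal kD) => //=; rewrite nth_index.
Qed.

(** Induction on the number n of rounds. The shape S0 of the last towers is chosen
    first, and the castle P of the first rounds is then taken Folner relatively
    to S0^-1: this is what makes the points s^-1 x, x in P, few outside P. With A
    the set of the points x off U with S0 x disjoint from P, and M the markers
    in A, the inequalities mu(~ P) <= mu(U) + mu(boundary) + mu(A) <= eta + mu(A)
    and mu(A) <= |W| mu(M) <= C |S0| mu(M) show that the new towers cover at least
    (mu(~ P) - eta) / C of the complement of P. *)
Lemma castle_exhaustion (C : nat) (n : nat) (K : {fset G}) (eps eta : R) :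
  (0 < C)%N ->
  (forall (K : {fset G}) (eps : R), 0 < eps -> exists S, folner K eps S /\
    (#|` [fset (s^-1 * s')%g | s in S, s' in S]%fset| <= C * #|` S|)%N) ->
  0 < eps -> 0 < eta ->
  exists (I : finType) (S : I -> {fset G}) (B : I -> set X),
    [/\ castle a S B, forall i, clopen (B i), forall i, folner K eps (S i),
        forall i s, s \in S i -> (diam (a s @` B i) < eps%:E)%E &
        forall mu, invariant_measures a mu ->
          (mu (~` footprint a S B) <= ((1 - C%:R^-1) ^+ n + eta)%:E)%E].
Proof.
move=> C0 doubling eps0 eta0.
elim: n => [|n IH] in K eps eps0 *.
  exists 'I_0, (fun _ => fset0), (fun _ => set0); split.
  - by split => [[]|[]].
  - by case.
  - by case.
  - by case.
  - move=> mu _; apply: (@le_trans _ _ 1%E).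
      apply: probability_le1; apply: clopen_measurable_borel.
      by apply: (clopenC set0); apply: clopen_footprint => -[].
    by rewrite lee_fin expr0 lerDl ltW.
have [S0 [fS0 dS0]] := doubling K eps eps0.
set W := [fset (s^-1 * s')%g | s in S0, s' in S0]%fset in dS0.
have [s0 s0S0] := folner_neq0 fS0.
have W1 : 1%g \in W by apply/imfset2P; exists s0 => //; exists s0; rewrite ?mulVg.
have WV g : g \in W -> g^-1%g \in W.
  move=> /imfset2P[s /= sS [s' /= s'S ->]]; rewrite invgM invgK; exact: in_imfset2.
have e20 : 0 < eta / 2 by rewrite divr_gt0.
(* U takes care of the points that are fixed by some g in W other than 1. *)
have cE : closed (\bigcup_(g in [set` (W `\ 1%g)%fset]) fixed_points a g).
  by apply: closed_bigcup => // g _; exact: closed_fixed_points.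
have [U [cU EU muU]] := small_clopen_nbhd cantorX cE e20 (fixed_points_bigcup_null W).
have [|k [V [cV Vfree Vdiam Vcov]]] := free_clopen_cover S0 (W := W) eps0 cU.
  by move=> g x gW g1 gx; apply: EU; exists g => //=; rewrite in_fsetD1 g1.
have eps'0 : 0 < Num.min eps (eta / 2) by rewrite lt_min eps0.
pose S0V := [fset s^-1%g | s in S0]%fset.
have [I [S [B [cSB cB fS dB muB]]]] := IH (K `|` S0V)%fset _ eps'0.
pose P := footprint a S B.
have cP : clopen P by exact: clopen_footprint.
pose A := ~` U `&` ~` (\bigcup_(s in [set` S0]) (a s^-1%g @` P)).
have cA : clopen A.
  apply: clopenI; apply: (clopenC set0) => //.
  by apply: clopen_bigcup => s _; exact: clopen_image_act.
pose M := markers a A V W k.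
have cM : clopen M by exact: clopen_markers.
pose N (j : 'I_k) := fresh a A V W (markers a A V W j) j.
have NM j : N j `<=` M by exact: fresh_sub.
have MA : M `<=` A by exact: markers_sub.
have M_inj s t x y : s \in S0 -> t \in S0 -> M x -> M y -> a s x = a t y -> s = t /\ x = y.
  move=> sS tS Mx My sxty.
  have yE : y = a (t^-1 * s)%g x by rewrite actM sxty actK.
  have [ts1|ts1] := eqVneq (t^-1 * s)%g 1%g.
    split; last by rewrite yE ts1 act1.
    by rewrite -[LHS](mulVKg t) ts1 mulg1.
  suff : set0 y by [].
  rewrite -(@markers_separated _ _ _ a A V W WV Vfree k _ (in_imfset2 _ _ tS sS) ts1).
  by split => //; exists x.
have N_inj s t j l x y : s \in S0 -> t \in S0 -> N j x -> N l y ->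
    a s x = a t y -> s = t /\ j = l.
  move=> sS tS Nx Ny E; have [st xy] := M_inj _ _ _ _ sS tS (NM _ _ Nx) (NM _ _ Ny) E.
  by split => //; apply/val_inj; rewrite -xy in Ny; exact: fresh_disjoint Nx Ny.
have N_new s j x : s \in S0 -> N j x -> ~ P (a s x).
  move=> sS /NM/MA[_ xP] Psx; apply: xP; exists s => //.
  by exists (a s x) => //; rewrite actK.
have cNj j : clopen (N j) by apply: clopen_fresh => //; exact: clopen_markers.
exists (I + 'I_k)%type, (extend_shape S S0 (k := k)), (extend_base B N); split.
- exact: extend_castle.
- by case.
- case=> [i|j] //=; apply: folnerS (fS i); first exact: fsubsetUl.
  by rewrite ge_min lexx.
- case=> [i|j] s /= sS; last first.
    apply: le_lt_trans (Vdiam j s sS); apply: diamS; apply: image_subset.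
    by move=> x [[]].
  by apply: lt_le_trans (dB i s sS) _; rewrite lee_fin ge_min lexx.
move=> mu inv; rewrite extend_footprint -markers_bigcup -/M -/P.
have mP : measurable (P : set (borel X)) by exact: clopen_measurable_borel.
have mU : measurable (U : set (borel X)) by exact: clopen_measurable_borel.
have mA : measurable (A : set (borel X)) by exact: clopen_measurable_borel.
set Q := \bigcup_(s in [set` S0]) (a s @` M).
have mQ : measurable (Q : set (borel X)).
  apply: clopen_measurable_borel; apply: clopen_bigcup => s _; exact: clopen_image_act.
have mbd : measurable (boundary a S0V S B : set (borel X)).
  by apply: open_measurable_borel; apply: open_boundary => i; exact: (cB i).1.
have muE D : measurable (D : set (borel X)) -> mu D = (fine (mu D))%:E.
  by move=> mD; rewrite fineK// fin_num_measure.
have bd_le : (mu (boundary a S0V S B) <= (eta / 2)%:E)%E.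
  apply: boundary_measure_le => // i; first exact: (cB i).1.
  by apply: folnerS (fS i); [exact: fsubsetUr|rewrite ge_min lexx orbT].
(* A point outside U and P that is not in A is s^-1 times a point of P. *)
have cover1 : ~` P `<=` U `|` boundary a S0V S B `|` A.
  move=> x nPx; have [Ux|nUx] := pselect (U x); first by left; left.
  have [[s sS [_ [i _ [t tS [y By <-]]] xE]]|xP] :=
    pselect ((\bigcup_(s in [set` S0]) (a s^-1%g @` P)) x); last by right.
  left; right; exists i => //; exists (s^-1 * t)%g; last by exists y; rewrite ?actM.
  rewrite /= in_fsetD in_imfset2 ?andbT//=; last by apply/imfsetP; exists s.
  apply/negP => stS; apply: nPx; exists i => //; exists (s^-1 * t)%g => //.
  by exists y; rewrite ?actM.
have h1 : fine (mu (~` P)) <= fine (mu U) + fine (mu (boundary a S0V S B)) + fine (mu A).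
  rewrite -lee_fin !EFinD -!muE//; last exact: measurableC.
  apply: (@le_trans _ _ (mu (U `|` boundary a S0V S B `|` A))).
    apply: le_measure; rewrite ?inE//; first exact: measurableC.
    by apply: measurableU => //; exact: measurableU.
  apply: le_trans (measureU2 _ _ _) _ => //; first exact: measurableU.
  by rewrite leeD2r// measureU2.
have mM : measurable (M : set (borel X)) by exact: clopen_measurable_borel.
have h2 : fine (mu A) <= (#|` W|)%:R * fine (mu M).
  rewrite -lee_fin EFinM -!muE//; apply: le_trans (translates_measure_le inv _ cM.1).
  apply: le_measure; rewrite ?inE//.
    apply: clopen_measurable_borel; apply: clopen_bigcup => g _; exact: clopen_image_act.
  move=> x Ax; have [j _ Vx] := Vcov _ Ax.1.
  exact: (@markers_cover _ _ _ a A V W W1 j k (ltn_ord j) x (conj Ax Vx)).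
have QE : fine (mu Q) = (#|` S0|)%:R * fine (mu M).
  apply: EFin_inj; rewrite EFinM -!muE//; apply: tower_measure => //; first exact: cM.1.
  by move=> s t /= sS tS [_ [[x Mx <-] [y My /esym/(M_inj _ _ _ _ sS tS Mx My)[]]]].
have QP x : Q x -> ~ P x.
  move=> [s sS [y My <-]]; move: My; rewrite /M markers_bigcup => -[j _ Ny].
  exact: N_new sS Ny.
have mPc : measurable (~` P : set (borel X)) by exact: measurableC.
have mPQ : measurable (~` (P `|` Q) : set (borel X)).
  by apply: measurableC; exact: measurableU.
have h3 : fine (mu (~` P)) = fine (mu (~` (P `|` Q))) + fine (mu Q).
  apply: EFin_inj; rewrite EFinD -(muE _ mPc) -(muE _ mPQ) -(muE _ mQ).
  rewrite -measureU//; last first.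
    by apply/seteqP; split => // x [nPQ Qx]; apply: nPQ; right.
  congr (mu _); apply/seteqP; split => x.
    by move=> nPx; have [Qx|nQx] := pselect (Q x); [right|left => -[]].
  by move=> [nPQ Px|/QP//]; apply: nPQ; left.
rewrite muE// lee_fin.
have := muB mu inv; rewrite -/P muE; last exact: measurableC.
have := muU mu inv; rewrite muE//.
move: bd_le; rewrite muE// !lee_fin => h4 h5 h6.
have m0 : 0 <= fine (mu M) by rewrite fine_ge0// measure_ge0.
have hW : (#|` W|)%:R <= C%:R * (#|` S0|)%:R :> R by rewrite -natrM ler_nat.
have h7 : fine (mu A) <= C%:R * fine (mu Q).
  by rewrite QE mulrA; apply: le_trans h2 _; rewrite ler_wpM2r.
have C_gt0 : 0 < C%:R :> R by rewrite ltr0n.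
have h8 : (fine (mu (~` P)) - eta) / C%:R <= fine (mu Q).
  by rewrite ler_pdivrMr// [leRHS]mulrC; apply: le_trans h7; lra.
have r0 : 0 <= 1 - C%:R^-1 :> R by rewrite subr_ge0 invf_le1// ler1n.
have h9 : (1 - C%:R^-1) * fine (mu (~` P)) <= (1 - C%:R^-1) * ((1 - C%:R^-1) ^+ n + eta).
  by rewrite ler_wpM2l.
(* With r = 1 - 1 / C: r (r ^ n + eta) + eta / C = r ^ n.+1 + eta. *)
rewrite exprS; move: h3 h8 h9; rewrite mulrDr !mulrBl !mul1r.
by rewrite [eta / _]mulrC [_ / C%:R]mulrC; lra.
Qed.

Lemma essentially_free_almost_finite (C : nat) :
  (forall (K : {fset G}) (eps : R), 0 < eps -> exists S, folner K eps S /\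
    (#|` [fset (s^-1 * s')%g | s in S, s' in S]%fset| <= C * #|` S|)%N) ->
  almost_finite_in_measure a.
Proof.
move=> doubling K eps eps0.
have C0 : (0 < C)%N.
  have [S [fS]] := doubling K eps eps0; have [s sS] := folner_neq0 fS.
  case: (C) => [|//]; rewrite mul0n leqn0 cardfs_eq0 => /eqP E.
  have : (s^-1 * s)%g \in [fset (s^-1 * s')%g | s in S, s' in S]%fset by exact: in_imfset2.
  by rewrite E.
have r1 : `|1 - C%:R^-1| < 1 :> R.
  have : C%:R^-1 <= 1 :> R by rewrite invf_le1 ?ltr0n// ler1n.
  have : 0 < C%:R^-1 :> R by rewrite invr_gt0 ltr0n.
  by move=> ? ?; rewrite ger0_norm; lra.
have e40 : 0 < eps / 4 by rewrite divr_gt0.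
have [n _ rn] := cvgr_lt (0 : R) (cvg_expr r1) _ e40.
have [I [S [B [cSB cB fS dB muB]]]] := castle_exhaustion n K C0 doubling eps0 e40.
exists I, S, B; split => //; first by split => // i; exact: (cB i).1.
apply: (@le_lt_trans _ _ (eps / 2)%:E); last by rewrite lte_fin; lra.
apply: ge_ereal_sup => _ [mu inv <-]; apply: le_trans (muB mu inv) _.
by rewrite lee_fin; have := rn n (leqnn n); rewrite /=; lra.
Qed.

End exhaustion.

(** * Finiteness of the kernel, and the equivalence *)

Section closed_orbits.
Variables (R : realType) (F : groupType) (X : pmetricType R) (b : action F X).
Hypothesis cantorX : is_cantor_set X.

(** The orbit of x is the preimage of a point of the orbit space, whose points are
    closed. *)
Lemma hausdorff_closed_orbit (x : X) :
  hausdorff_space (orbit_space b) -> closed (orbit_of b x).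
Proof.
move=> /hausdorff_accessible/accessible_closed_set1 cl1.
have -> : orbit_of b x =
    (\pi_(orbit_space b)%qT : X -> orbit_space b) @^-1` [set \pi_(orbit_space b)%qT x].
  apply/seteqP; split => y /=.
    by move=> xy; apply/eqmodP; rewrite /= same_orbit_sym; apply/asboolP.
  by move=> /eqmodP /=; rewrite same_orbit_sym => /asboolP.
apply: preimage_closed; last exact: cl1.
by move=> y _; exact: pi_continuous.
Qed.

(** The translates of V cover the orbit and each of them contains only one of its
    points, so a finite subcover bounds the number of points. *)
Lemma isolated_orbit_finite (x y : X) (V : set X) : closed (orbit_of b x) ->
  open V -> orbit_of b x `&` V = [set y] -> finite_set (orbit_of b x).
Proof.
move=> clO oV OVy.
have [f0 _ xy] : orbit_of b x y by have : [set y] y by []; rewrite -OVy => -[].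
have Vy : V y by have : [set y] y by []; rewrite -OVy => -[].
have [D _ cov] : finite_subset_cover setT (fun f => b f @` V) (orbit_of b x).
  have : compact (orbit_of b x).
    by apply: (subclosed_compact clO (cantor_compact cantorX)).
  rewrite compact_cover; apply=> [f _|_ [f _ <-]]; first exact: open_image_act.
  by exists (f * f0^-1)%g => //; exists y => //; rewrite -xy -actM mulgVK.
apply: (sub_finite_set (B := (fun f => b f y) @` [set` D])); last exact: finite_image.
move=> z Oz; have [f /= fD [v Vv fv]] := cov _ Oz; exists f => //.
have : (orbit_of b x `&` V) v.
  split=> //; have [g _ gz] := Oz; exists (f^-1 * g)%g => //.
  by rewrite actM gz -fv actK.
by rewrite OVy => /= <-.
Qed.

(** If the orbit O were infinite, no clopen set could meet it in a single point.
    One could then choose decreasing clopen sets W n that meet O, such that W n.+1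
    avoids the n-th point of O; by compactness their intersection would contain
    a point of O. *)
Lemma closed_orbit_finite (x : X) : countable [set: F] ->
  closed (orbit_of b x) -> finite_set (orbit_of b x).
Proof.
move=> /countable_injP[e e_inj] clO; apply: contrapT => infO.
pose u n := xget 1%g [set f | e f = n].
have uK f : u (e f) = f.
  rewrite /u; case: xgetP => [g _ gf|no].
    exact: (e_inj _ _ (mem_set I) (mem_set I) gf).
  by case: (no f).
set O := orbit_of b x in clO infO.
pose T := {V : set X | clopen V /\ O `&` V !=set0}.
have step (Vn : T * nat) : exists V' : T,
    sval V' `<=` sval Vn.1 /\ ~ sval V' (b (u Vn.2) x).
  case: Vn => -[V [cV OV]] n /=; set y := b (u n) x.
  have [z [Oz Vz zy]] : exists z, [/\ O z, V z & z <> y].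
    apply: contrapT => no; apply: infO.
    apply: (isolated_orbit_finite (y := y) clO cV.1); apply/seteqP; split => z.
      by move=> [Oz Vz] /=; apply: contrapT => zy; apply: no; exists z.
    by move=> ->; have [z' [Oz' Vz']] := OV; have -> : y = z' by
      [apply: contrapT => zy; apply: no; exists z'; split => // /esym].
  have [|C [cC Cz Cy]] := clopen_nbhs cantorX (x := z) (O := ~` [set y]).
    apply: open_nbhs_nbhs; split => //; apply: closed_openC.
    exact/accessible_closed_set1/hausdorff_accessible/metric_hausdorff.
  have VC : clopen (V `&` C) /\ O `&` (V `&` C) !=set0.
    by split; [exact: clopenI|exists z].
  by exists (exist _ (V `&` C) VC) => /=; split => [w []//|[_ /Cy /(_ erefl)]].
have [h hP] := choice step.
have T0 : clopen [set: X] /\ O `&` [set: X] !=set0.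
  by split; [exact: clopenT|exists x; split => //; exists 1%g; rewrite ?act1].
pose W := fix W n : T := if n is m.+1 then h (W m, m) else exist _ setT T0.
have Wdec m n : (m <= n)%N -> sval (W n) `<=` sval (W m).
  move=> /subnK <-; elim: (n - m)%N => [//|k IH].
  by rewrite addSn /=; apply: subset_trans IH; exact: (hP (_, _)).1.
have [D _ cov] : finite_subset_cover setT (fun n => ~` sval (W n)) O.
  have : compact O by apply: (subclosed_compact clO (cantor_compact cantorX)).
  rewrite compact_cover; apply=> [n _|_ [f _ <-]].
    by apply: closed_openC; exact: (svalP (W n)).1.2.
  by exists (e f).+1 => //=; have := (hP (W (e f), e f)).2; rewrite /= uK.
have [z [Oz Wz]] := (svalP (W (\max_(n <- D) n)%N)).2.
have [n nD] := cov _ Oz; apply; apply: Wdec Wz.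
exact: (leq_bigmax_seq (F := fun k : nat => k)).
Qed.

Lemma stabilizer_neq1 (x : X) : infinite_set [set: F] ->
  finite_set (orbit_of b x) -> exists2 f, f != 1%g & b f x = x.
Proof.
move=> infF finO; apply: contrapT => no; apply: infF.
have -> : [set: F] = (b ^~ x) @^-1` orbit_of b x.
  by apply/seteqP; split => // f _; exists f.
apply: finite_preimage finO => f g _ _ fg; apply/eqP.
have : (g^-1 * f)%g == 1%g.
  apply/negPn/negP => gf1; apply: no; exists (g^-1 * f)%g => //.
  by rewrite actM fg actK.
by move=> /eqP /(congr1 (fun z => (g * z)%g)); rewrite mulVKg mulg1 => ->.
Qed.

End closed_orbits.

(** If F is infinite, then every point is fixed by some f <> 1, since its F-orbit
    is finite; X is then a countable union of null sets. An invariant measure is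
    available here because essential freeness gives the value 0, and not -oo, to
    a supremum over the invariant measures. *)
Lemma kernel_finite (R : realType) (F G : groupType) (i : {multiplicative F -> G})
    (X : pmetricType R) (alpha : action G X) :
  is_cantor_set X -> injective i -> countable [set: F] ->
  hausdorff_space (orbit_space (restrict_action i alpha)) ->
  essentially_free alpha -> finite_set [set: F].
Proof.
move=> cX i_inj cF hX ef; apply: contrapT => infF.
have stab x : exists2 f, f != 1%g & restrict_action i alpha f x = x.
  apply: stabilizer_neq1 => //; apply: closed_orbit_finite => //.
  exact: hausdorff_closed_orbit.
have i1 f : f != 1%g -> i f != 1%g.
  by apply: contra_neq => if1; apply: i_inj; rewrite if1 group_morph1.
have [mu inv] : exists mu, invariant_measures alpha mu.
  have [f f1 _] := stab point; apply: contrapT => no.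
  have no_inv : invariant_measures alpha = set0.
    by apply/seteqP; split => // mu inv; apply: no; exists mu.
  by have := ef _ (i1 f f1); rewrite /sup_measure no_inv image_set0 ereal_sup0.
have /countable_injP[e e_inj] := cF.
pose A n := [set x | exists f, [/\ e f = n, f != 1%g & alpha (i f) x = x]].
have A0 n : mu.-negligible (A n : set (borel X)).
  have [[f [fn f1]]|no] := pselect (exists f, e f = n /\ f != 1%g).
    exists (fixed_points alpha (i f)); split.
    - by apply: closed_measurable_borel; exact: closed_fixed_points.
    - by apply: essentially_free_null => //; exact: i1.
    - move=> x [g [gn _ gx]].
      by have <- : g = f by apply: e_inj; rewrite ?inE// gn.
  rewrite (_ : A n = set0); first exact: negligible_set0.
  by apply/seteqP; split => // x [f [fn f1 _]]; apply: no; exists f.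
have AT : \bigcup_n A n = [set: X].
  by apply/seteqP; split => // x _; have [f f1 fx] := stab x; exists (e f) => //; exists f.
have := negligible_bigcup A0; rewrite AT => muT.
have : mu setT = 0%E by exact: measure_negligible measurableT muT.
by rewrite probability_setT => /eqP; rewrite onee_eq0.
Qed.

Theorem theoremA (R : realType) (F G H : groupType)
  (i : {multiplicative F -> G}) (rho : {multiplicative G -> H})
  (X : pmetricType R) (alpha : action G X) :
  countable [set: F] -> countable [set: G] -> countable [set: H] ->
  short_exact i rho ->
  locally_finite F -> virtually_Z H ->
  is_cantor_set X ->
  minimal_action alpha ->
  hausdorff_space (orbit_space (restrict_action i alpha)) ->
  almost_finite_in_measure alpha <-> essentially_free alpha.
Proof.
move=> cF cG _ exact_i_rho lfF vZ cX _ hX.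
have [T [t [t_inf T_cover]]] := extension_decomposition exact_i_rho vZ.
split=> [|ef].
  apply: almost_finite_essentially_free.
  apply: folner_invariant_measure => // K eps eps0.
  exact: (locally_finite_folner exact_i_rho t_inf T_cover).
have [i_inj _ _] := exact_i_rho.
have finF := kernel_finite cX i_inj cF hX ef.
have [C doubling] := folner_doubling exact_i_rho t_inf T_cover finF.
apply: (essentially_free_almost_finite cX _ (C := C)); last exact: doubling.
by move=> s mu s1 inv; exact: essentially_free_null.
Qed.
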